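(* Let $W=\langle s,t: s^2=t^2=(st)^m=1\rangle$ be a Coxeter group of rank $2$ with $S=\{s,t\}$, $m\ge 2$ the order of $st$, and $w_0$ its longest element. Then $\Phi_S=\operatorname{Ind}_{\langle w_0\rangle}^W(1)-1_S$ and $\Psi_S=\pi_{\mathcal A}-1_S=\Phi_S\epsilon_S$. Moreover, the cuspidal conjugacy classes of $W$ are represented by $(st)^j$, $j=1,\dots,\lfloor m/2\rfloor$, and with $\varphi_{(st)^j}=\chi_j$ if $m$ is odd, and $\varphi_{(st)^j}=\chi_{2j}$ for $0<j<m/2$, $\varphi_{w_0}=\epsilon_S$ if $m$ is even, and $\psi_{(st)^j}=\varphi_{(st)^j}\epsilon$, these are linear characters of $C_W((st)^j)$ satisfying $\Phi_S=\sum_{j}\operatorname{Ind}_{C_W((st)^j)}^W\varphi_{(st)^j}$ and $\Psi_S=\sum_j\operatorname{Ind}_{C_W((st)^j)}^W\psi_{(st)^j}$ (sums over $j=1,\dots,\lfloor m/2\rfloor$).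
   Context: $1_S,\epsilon_S$ are the trivial and sign characters of $W$ ($\epsilon$ also denotes restrictions of $\epsilon_S$). $W^+=\langle st\rangle$; for a fixed primitive $m$-th root of unity $\zeta_m$, $\chi_j$ is the linear character of $W^+$ with $\chi_j(st)=\zeta_m^j$. $\pi_{\mathcal A}$ is the permutation character of $W$ on the set $\mathcal A$ of reflecting hyperplanes. $\Phi_S$ is the character of $W$ on $e_S\mathbb CW$ (right multiplication), where: for $J\subseteq S$, $X_J=\{w:\ell(rw)>\ell(w)\ \forall r\in J\}$, $x_J=\sum_{x\in X_J}x^{-1}$, $X_J^\sharp=\{x\in X_J:x^{-1}Jx\subseteq S\}$, $m_{KL}=|X_K\cap X_L^\sharp|$ if $L\subseteq K$ and $0$ otherwise, and $e_L$ is defined by $x_K=\sum_Lm_{KL}e_L$. $\Psi_S$ is the character of $W$ on the degree $2$ component of the Orlik–Solomon algebra $A(W)$ (generated by $a_t$, $t$ a reflection, with $a_ta_{t'}=-a_{t'}a_t$ and $\sum_{i=1}^p(-1)^ia_{t_1}\cdots\widehat{a_{t_i}}\cdots a_{t_p}=0$ for linearly dependent $\{H_{t_i}\}$; $W$ acts by $a_t.w=a_{w^{-1}tw}$). An element is cuspidal if it has no nonzero fixed vector in the reflection representation. *)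

(* Defs.v *)
From HB Require Import structures.
From mathcomp Require Import all_boot all_order all_algebra all_fingroup.
From mathcomp Require Import all_solvable all_field all_character.
Set Implicit Arguments. Unset Strict Implicit. Unset Printing Implicit Defensive.
Import Order.TTheory GRing.Theory Num.Theory.
Local Open Scope ring_scope.

(* trace of R restricted to the (R-invariant) row space U *)
Definition restr_trace (n : nat) (U R : 'M[algC]_n) : algC :=
  \tr (row_base U *m R *m pinvmx (row_base U)).

(* trace of the map induced by R on the quotient V/U (U <= V, both R-invariant):
   C is a complement of U in V, and c |-> (c R projected on C along U). *)
Definition quot_trace (n : nat) (V U R : 'M[algC]_n) : algC :=
  let C := (V :\: U)%MS in
  \tr (row_base C *m R *m proj_mx C U *m pinvmx (row_base C)).

Section Coxeter.
Variables (gT : finGroupType) (s t : gT).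

Definition Sset : {set gT} := [set s; t].

Fixpoint words (n : nat) : {set gT} :=
  if n is n'.+1 then (Sset * words n')%g else [set 1%g]%g.

(* Coxeter length l(w): least n with w a product of n elements of S
   (the search bound #|gT| exceeds the length of any element of <S>). *)
Definition clen (w : gT) : nat :=
  find (fun n => w \in words n) (iota 0 #|gT|.+1).

Definition sgnS (w : gT) : algC := (-1) ^+ clen w.

Definition longest (W : {set gT}) : gT := [arg max_(w > 1%g in W) clen w].

Variable W : {set gT}.

Definition Xset (J : {set gT}) : {set gT} :=
  [set w in W | [forall r in J, (clen w < clen (r * w)%g)%N]].
Definition Xsharp (J : {set gT}) : {set gT} :=
  [set x in Xset J | (J :^ x)%g \subset Sset].
Definition mKL (K L : {set gT}) : nat :=
  if L \subset K then #|Xset K :&: Xsharp L| else 0.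

(* group algebra CW: row vectors indexed by gT (supported on W) *)
Definition gel (g : gT) : 'rV[algC]_#|gT| := delta_mx 0 (enum_rank g).
Definition gmul (a b : 'rV[algC]_#|gT|) : 'rV[algC]_#|gT| :=
  \row_k \sum_i \sum_(j | (enum_val i * enum_val j == enum_val k)%g) a 0 i * b 0 j.

Definition xK (K : {set gT}) : 'rV[algC]_#|gT| := \sum_(x in Xset K) gel x^-1.

(* e_K by solving the unitriangular system x_K = sum_{L <= K} m_KL e_L
   (recursion on proper subsets, fuel = #|K|) *)
Fixpoint eaux (k : nat) (K : {set gT}) : 'rV[algC]_#|gT| :=
  ((mKL K K)%:R)^-1 *:
    (xK K - match k with
            | 0 => 0
            | k'.+1 => \sum_(L : {set gT} | L \proper K) (mKL K L)%:R *: eaux k' L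
            end).
Definition eL (K : {set gT}) : 'rV[algC]_#|gT| := eaux #|K| K.

Definition Rg (w : gT) : 'M[algC]_#|gT| :=
  \matrix_(i, j) ((enum_val j == enum_val i * w)%g)%:R.

Definition eSCW : 'M[algC]_#|gT| := (\sum_(g in W) <<gmul (eL Sset) (gel g)>>)%MS.

Definition Phi_S (w : gT) : algC := restr_trace eSCW (Rg w).

Variable rho : gT -> 'M[algC]_2.

Definition refls : {set gT} := ((s ^: W) :|: (t ^: W))%g.

(* reflecting hyperplane of r (fixed row vectors), in canonical form *)
Definition hyp (r : gT) : 'M[algC]_2 := <<kermx (rho r - 1%:M)>>%MS.
Definition hyps : seq 'M[algC]_2 := undup [seq hyp r | r <- enum refls].

Definition piA (w : gT) : algC :=
  (count (fun H => <<H *m rho w>>%MS == H) hyps)%:R.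

(* {H_{t_1},...,H_{t_p}} linearly dependent: their defining linear forms
   (spanning the column spaces of rho t_i - 1) are linearly dependent *)
Definition hdep (ts : seq gT) : bool :=
  (\rank (\sum_(r <- ts) <<(rho r - 1%:M)^T>>)%MS < size ts)%N.

(* exterior square: antisymmetric functions on gT * gT *)
Definition pvec (p : gT * gT) : 'rV[algC]_#|{: gT * gT}| := delta_mx 0 (enum_rank p).
Definition wedge (x y : gT) := pvec (x, y) - pvec (y, x).

Definition Lam2 : 'M[algC]_#|{: gT * gT}| :=
  (\sum_(x in refls) \sum_(y in refls) <<wedge x y>>)%MS.

(* degree-2 part of the Orlik-Solomon ideal: generated by
   r_D = sum_i (-1)^i a_{t_1}..^{a_{t_i}}..a_{t_p} for dependent D, p = 3, 2, 1 *)
Definition OSrel : 'M[algC]_#|{: gT * gT}| :=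
  ((\sum_(x in refls) \sum_(y in refls) \sum_(z in refls | hdep [:: x; y; z])
      <<wedge x z - wedge y z - wedge x y>>)
   + (\sum_(u in refls) \sum_(x in refls) \sum_(y in refls | hdep [:: x; y])
      <<wedge u x - wedge u y>>)
   + (\sum_(u in refls) \sum_(v in refls) \sum_(x in refls | hdep [:: x])
      <<- wedge u v>>))%MS.

Definition Rp (w : gT) : 'M[algC]_#|{: gT * gT}| :=
  \matrix_(i, j) ((enum_val j == (((enum_val i).1 ^ w)%g, ((enum_val i).2 ^ w)%g)))%:R.

Definition Psi_S (w : gT) : algC := quot_trace Lam2 OSrel (Rp w).

Definition cuspidal (w : gT) : bool := (\rank (kermx (rho w - 1%:M)) == 0)%N.

End Coxeter.

Section Chars.
Variables (gT : finGroupType) (s t : gT) (m : nat) (z : algC).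

Definition chi (j : nat) (x : gT) : algC :=
  z ^+ (j * odflt 0%N (omap val [pick k : 'I_m | ((s * t) ^+ k)%g == x]))%N.

Definition phi (j : nat) (x : gT) : algC :=
  if odd m then chi j x
  else if j.*2 == m then sgnS s t x else chi j.*2 x.

Definition psi (j : nat) (x : gT) : algC := phi j x * sgnS s t x.
End Chars.

(* Main.v *)
(** Write [r = s t].  Walking around the Cayley graph of [W], a cycle of length
    [2 m], gives the length function and [e_S = mean <w_0> - mean W].  For
    [H <= K <= W] the right ideal generated by [mean H - mean K] affords
    [Ind_H 1 - Ind_K 1], which yields [Phi_S].  A rotation has determinant [1]
    and finite order, so it fixes no nonzero vector unless it is trivial.  Hence
    distinct reflections have distinct hyperplanes, any three of which are
    dependent, and the degree [2] part of the Orlik-Solomon algebra is the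
    exterior square modulo all [a_y a_z - a_x a_z + a_x a_y].  The map
    [a_x a_y |-> a_y - a_x] identifies it with the augmentation ideal of the
    permutation module on the reflections, so [Psi_S w] is the number of
    reflections commuting with [w], minus [1].  On rotations [phi_j] is the
    [j]-th power of one linear character, and the sum of the induced characters
    becomes a sum of powers of a root of unity. *)
Require Import Defs.
From mathcomp Require Import all_boot all_order all_algebra all_fingroup.
From mathcomp Require Import all_solvable all_field all_character.
From mathcomp Require Import zify ring.

Set Implicit Arguments.
Unset Strict Implicit.
Unset Printing Implicit Defensive.

Import Order.TTheory GRing.Theory Num.Theory.
Local Open Scope ring_scope.

(** * Traces on subspaces and quotients *)

Lemma restr_trace_retract n k (U R : 'M_n) (D : 'M_(n, k)) (E : 'M_(k, n)) :
    stablemx U R -> (E <= U)%MS -> U *m D *m E = U ->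
  restr_trace U R = \tr (E *m R *m D).
Proof.
move=> UR sEU UDE; rewrite /restr_trace; set B := row_base U.
have BU : (B :=: U)%MS := eq_row_base U.
have BDE : B *m D *m E = B.
  have /submxP[A ->] : (B <= U)%MS by rewrite BU.
  by rewrite -!mulmxA (mulmxA U) UDE.
rewrite -{1}BDE -!(mulmxA (B *m D)) mxtrace_mulC mulmxA mulmxKpV // BU.
exact: submx_trans (submxMr R sEU) UR.
Qed.

Lemma quot_trace_retract n k (V U R : 'M_n) (D : 'M_(n, k)) (E : 'M_(k, n)) :
    (U <= V)%MS -> stablemx U R -> stablemx V R ->
    (E <= V)%MS -> U *m D = 0 -> (V *m (1%:M - D *m E) <= U)%MS ->
  quot_trace V U R = \tr (E *m R *m D).
Proof.
move=> sUV UR VR sEV UD VDE; set C := (V :\: U)%MS; set p := proj_mx C U.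
have CUV : (C + U :=: V)%MS.
  apply: eqmx_trans (addsmx_diff_cap_eq V U).
  by apply: adds_eqmx => //; apply/eqmx_sym/capmx_idPr.
have sCV : (C <= V)%MS by rewrite diffmxSl.
have Cp : C *m p = C by rewrite proj_mx_id // capmx_diff.
have Up j (A : 'M_(j, n)) : (A <= U)%MS -> A *m p = 0.
  by move=> AU; rewrite proj_mx_0 // capmx_diff.
have pmodU j (A : 'M_(j, n)) : (A <= V)%MS -> (A - A *m p <= U)%MS.
  by move=> AV; rewrite proj_mx_compl_sub ?CUV.
have pC j (A : 'M_(j, n)) : (A *m p <= C)%MS by rewrite proj_mx_sub.
have -> : quot_trace V U R = restr_trace C (R *m p).
  by rewrite /quot_trace /restr_trace -(mulmxA _ R p).
clearbody p.
have sERV : (E *m R <= V)%MS := submx_trans (submxMr R sEV) VR.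
have UD0 j (A : 'M_(j, n)) : (A <= U)%MS -> A *m D = 0.
  by case/submxP=> A' ->; rewrite -mulmxA UD mulmx0.
have CDEp : C *m D *m (E *m p) = C.
  rewrite -[RHS]Cp mulmxA; apply/esym/eqP; rewrite -subr_eq0 -mulmxBl Up //.
  by rewrite -{1}[C]mulmx1 -mulmxA -mulmxBr (submx_trans _ VDE) ?submxMr.
rewrite (restr_trace_retract _ _ CDEp) ?mulmxA //.
have -> : E *m p *m R *m p = E *m R *m p.
  apply/esym/eqP; rewrite -subr_eq0 -!mulmxBl; apply/eqP/Up.
  by rewrite (submx_trans _ UR) // submxMr // pmodU.
by congr (\tr _); apply/esym/eqP; rewrite -subr_eq0 -mulmxBl UD0 // pmodU.
Qed.

(** * Square matrices of size two *)

Section SquareMatrices2.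

Variable F : comNzRingType.
Implicit Type A : 'M[F]_2.

Lemma ord2P (i : 'I_2) : i = 0 \/ i = 1.
Proof. by case: i => [[|[|//]] ltk]; [left | right]; apply: val_inj. Qed.

Lemma mxtrace2 A : \tr A = A 0 0 + A 1 1.
Proof.
by rewrite /mxtrace big_ord_recl big_ord1; congr (A _ _ + A _ _); apply: val_inj.
Qed.

Lemma det_mx22 A : \det A = A 0 0 * A 1 1 - A 0 1 * A 1 0.
Proof.
rewrite (expand_det_row _ 0) big_ord_recl big_ord1 /cofactor !det_mx11 !mxE /=.
rewrite expr0 mul1r expr1 mulN1r mulrN.
by congr (A _ _ * A _ _ - A _ _ * A _ _); apply: val_inj.
Qed.

Lemma det_sub1_mx22 A : \det (A - 1%:M) = 1 - \tr A + \det A.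
Proof. by rewrite mxtrace2 !det_mx22 !mxE /=; ring. Qed.

Lemma sqr_mx22 A : A *m A = \tr A *: A - (\det A)%:M.
Proof.
apply/matrixP=> i j; rewrite mxtrace2 det_mx22 !mxE big_ord_recl big_ord1.
have -> : lift ord0 0 = 1 :> 'I_2 by apply: val_inj.
by case: (ord2P i) (ord2P j) => -> [] ->; rewrite ?mulr1n ?mulr0n; ring.
Qed.

End SquareMatrices2.

Lemma det_mx22_eq0 (F : fieldType) (A : 'M[F]_2) :
  (\det A == 0) = (\rank A != 2%N).
Proof.
by rewrite -[_ != _]/(~~ row_free A) row_free_unit unitmxE unitfE negbK.
Qed.

Lemma unipotent_expr_eq1 (F : numFieldType) (L : lalgType F) (a : L) n :
  (0 < n)%N -> a ^+ n = 1 -> (a - 1) ^+ 2 = 0 -> a = 1.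
Proof.
move=> n_gt0 an1 a1_sqr0.
have aX k : a ^+ k = 1 + (a - 1) *+ k.
  elim: k => [|k IHk]; first by rewrite addr0.
  rewrite exprSr IHk -{2}[a](subrK 1) [a - 1 + 1]addrC mulrDr mulr1 mulrDl mul1r.
  by rewrite mulrnAl -expr2 a1_sqr0 mul0rn addr0 -addrA -mulrSr.
move/eqP: an1; rewrite aX addrC -subr_eq0 addrK -scaler_nat scaler_eq0.
by rewrite pnatr_eq0 -[_ == 0%N]negbK -lt0n n_gt0 subr_eq0 => /eqP.
Qed.

Lemma det1_mx22_eq1 (F : numFieldType) (A : 'M[F]_2) n :
    (0 < n)%N -> A ^+ n = 1 -> \det A = 1 -> \det (A - 1%:M) = 0 ->
  A = 1.
Proof.
move=> n_gt0 An1 detA det0; apply: unipotent_expr_eq1 n_gt0 An1 _.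
have trA : \tr A = 2.
  by move: det0; rewrite det_sub1_mx22 detA addrAC => /subr0_eq <-.
rewrite sqrrB1 expr2 -[A * A]/(A *m A) sqr_mx22 trA detA scaler_nat.
by rewrite -[1%:M]/1 [X in X + 1]addrAC subrr add0r addNr.
Qed.

Lemma det_sub1_reflection (F : fieldType) (A : 'M[F]_2) :
  A *m A = 1%:M -> \det A = -1 -> \det (A - 1%:M) = 0.
Proof.
move=> AA detA; rewrite det_sub1_mx22 detA.
suff -> : \tr A = 0 by rewrite subr0 subrr.
have := sqr_mx22 A; rewrite AA detA raddfN opprK -[X in X = _]add0r.
move/addIr/esym/eqP; rewrite scaler_eq0 => /orP[/eqP //|/eqP A0].
by move/eqP: detA; rewrite A0 det0 eq_sym oppr_eq0 oner_eq0.
Qed.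

(** * Roots of unity and linear characters *)

Section RootsOfUnity.

Variables (F : fieldType) (y : F).

Lemma sum_unity_root n : (0 < n)%N -> y ^+ n = 1 ->
  \sum_(1 <= j < n) y ^+ j = n%:R * (y == 1)%:R - 1.
Proof.
move=> n_gt0 yn1; have [->|y_neq1] := eqVneq y 1.
  by under eq_bigr do rewrite expr1n; rewrite sumr_const_nat mulr1 natrB.
apply/eqP; rewrite mulr0 sub0r -subr_eq0 opprK addrC -{1}(expr0 y) -big_ltn //.
rewrite big_mkord; have /esym/eqP := subrX1 y n.
by rewrite yn1 subrr mulf_eq0 subr_eq0 (negPf y_neq1).
Qed.

Lemma expf_unity_rootV n j : (j <= n)%N -> y ^+ n = 1 -> y ^- j = y ^+ (n - j).
Proof. by move=> le_jn yn1; apply: mulr1_eq; rewrite -exprD subnKC. Qed.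

Lemma sum_unity_root_sym n : (0 < n)%N -> y ^+ n = 1 ->
  \sum_(1 <= j < n) (y ^+ j + y ^- j) = 2 * (n%:R * (y == 1)%:R - 1).
Proof.
move=> n_gt0 yn1; rewrite big_split /= [X in _ + X]big_nat_rev /=.
rewrite [X in _ + X](eq_big_nat _ _ (F2 := fun j => y ^+ j)) => [|j /andP[_ ltjn]].
  by rewrite sum_unity_root // [RHS]mulr_natl.
by rewrite subSS (expf_unity_rootV _ yn1) ?leq_subr // subKn // ltnW.
Qed.

Lemma sum_odd_unity_root_sym n : odd n -> y ^+ n = 1 ->
  \sum_(1 <= j < n./2.+1) (y ^+ j + y ^- j) = n%:R * (y == 1)%:R - 1.
Proof.
move=> n_odd yn1; rewrite -sum_unity_root ?odd_gt0 //.
rewrite [RHS](big_cat_nat _ (n := n./2.+1)) /=; [|lia|lia].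
rewrite big_split -[X in \sum_(X <= _ < n) _]add1n big_addn /=.
rewrite [X in _ = _ + X]big_nat_rev /=; congr (_ + _).
have -> : (n - n./2 = n./2.+1)%N by lia.
apply: eq_big_nat => j j_lt; rewrite (expf_unity_rootV _ yn1); last lia.
by congr (_ ^+ _); lia.
Qed.

End RootsOfUnity.

Lemma lin_char_of_morph (gT : finGroupType) (G : {group gT}) (f : gT -> algC) :
    f 1%g = 1 -> {in G &, {morph f : x y / (x * y)%g >-> x * y}} ->
  {xi : 'CF(G) | xi \is a linear_char & {in G, xi =1 f}}.
Proof.
move=> f1 fM; have f_repr : mx_repr G (fun x => (f x)%:M : 'M[algC]_1).
  by split=> [|x y Gx Gy]; rewrite ?f1 // fM // scalar_mxM.
have chiE : {in G, cfRepr (MxRepresentation f_repr) =1 f}.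
  by move=> x Gx; rewrite cfunE Gx mulr1n mxtrace_scalar.
exists (cfRepr (MxRepresentation f_repr)); rewrite // qualifE /=.
by rewrite cfRepr_char chiE ?group1 ?f1 /=.
Qed.

(** * Right ideals of the group algebra *)

Lemma sum_natr_mem (R : pzSemiRingType) (I : finType) (A B : {set I}) :
  \sum_(i in A) (i \in B)%:R = #|A :&: B|%:R :> R.
Proof.
rewrite -sum1_card natr_sum big_mkcond [RHS]big_mkcond; apply: eq_bigr => i _.
by rewrite inE; case: (i \in A) (i \in B) => [] [].
Qed.

Lemma sum_setUI (V : nmodType) (I : finType) (A B : {set I}) (F : I -> V) :
  \sum_(i in A) F i + \sum_(i in B) F i
    = \sum_(i in A :|: B) F i + \sum_(i in A :&: B) F i.
Proof.
rewrite ![\sum_(i in _) _]big_mkcond -!big_split; apply: eq_bigr => i _ /=.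
by rewrite !inE; case: (i \in A) (i \in B) => [] []; rewrite ?addr0 ?add0r.
Qed.

Lemma sum_mulr_pred1 (R : nzSemiRingType) (I : finType) (i0 : I) (F : I -> R) :
  \sum_i F i * (i == i0)%:R = F i0.
Proof.
rewrite (bigD1 i0) //= eqxx mulr1 big1 ?addr0 // => i /negPf->.
exact: mulr0.
Qed.

Lemma mean_const (I : finType) (A : {set I}) (V : lmodType algC) (v : V) :
  (0 < #|A|)%N -> #|A|%:R^-1 *: (\sum_(i in A) v) = v.
Proof.
move=> A_gt0; rewrite sumr_const -scaler_nat scalerA mulVf ?scale1r //.
by rewrite pnatr_eq0 -lt0n.
Qed.

Section GroupAlgebra.

Variable gT : finGroupType.
Implicit Types (a b e : 'rV[algC]_#|gT|) (g h x y : gT) (H K W : {group gT}).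

Local Notation coef a g := (a 0 (enum_rank g)).

Lemma coefP a b : (forall g, coef a g = coef b g) -> a = b.
Proof. by move=> eq_ab; apply/rowP=> i; rewrite -(enum_valK i). Qed.

Lemma coef_gel g h : coef (gel g) h = (h == g)%:R.
Proof. by rewrite mxE eqxx (inj_eq enum_rank_inj). Qed.

Lemma coef_sum_gel (A : {set gT}) g : coef (\sum_(h in A) gel h) g = (g \in A)%:R.
Proof.
rewrite summxE big_mkcond -(sum_mulr_pred1 g (fun h => (h \in A)%:R)).
apply: eq_bigr => h _; rewrite coef_gel eq_sym.
by case: ifP; rewrite ?mul1r ?mul0r.
Qed.

Lemma gel_decomp a : a = \sum_g coef a g *: gel g.
Proof. by rewrite {1}[a]row_sum_delta (reindex _ (onW_bij _ (enum_rank_bij _))). Qed.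

Lemma mxtrace_gel (A : 'M_#|gT|) : \tr A = \sum_g coef (gel g *m A) g.
Proof.
rewrite /mxtrace (reindex _ (onW_bij _ (enum_rank_bij _))).
by apply: eq_bigr => g _; rewrite -rowE mxE.
Qed.

Lemma coef_mul_Rg a w g : coef (a *m Rg w) g = coef a (g * w^-1)%g.
Proof.
rewrite mxE (reindex _ (onW_bij _ (enum_rank_bij _))) /=.
rewrite -[RHS](sum_mulr_pred1 _ (fun h => coef a h)).
apply: eq_bigr => h _; rewrite mxE !enum_rankK; congr (_ * (nat_of_bool _)%:R).
by rewrite eq_sym -(inj_eq (mulIg w^-1%g)) mulgK.
Qed.

Lemma coef_gmul a b k :
  coef (gmul a b) k = \sum_y coef a (k * y^-1)%g * coef b y.
Proof.
rewrite mxE (exchange_big_dep xpredT) //=.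
rewrite (reindex _ (onW_bij _ (enum_rank_bij _))) /=; apply: eq_bigr => y _.
rewrite (big_pred1 (enum_rank (k * y^-1)%g)) // => i /=.
rewrite !enum_rankK -(inj_eq (mulIg y^-1%g)) mulgK.
by rewrite -(inj_eq enum_val_inj) enum_rankK.
Qed.

Lemma coef_gmul_gel a g k : coef (gmul a (gel g)) k = coef a (k * g^-1)%g.
Proof.
by rewrite coef_gmul; under eq_bigr do rewrite coef_gel; apply: sum_mulr_pred1.
Qed.

Lemma gmul_gel_Rg a g w : gmul a (gel g) *m Rg w = gmul a (gel (g * w)%g).
Proof. by apply: coefP => k; rewrite coef_mul_Rg !coef_gmul_gel invMg mulgA. Qed.

Section RightIdeal.

Variables (W : {group gT}) (e : 'rV[algC]_#|gT|).
Hypothesis e_supp : forall g, g \notin W -> coef e g = 0.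
Hypothesis e_idem : gmul e e = e.

Definition right_ideal : 'M_#|gT| := (\sum_(g in W) <<gmul e (gel g)>>)%MS.

(* Left multiplication by [e], cut off outside [W] so that its image is the ideal. *)
Definition right_ideal_proj : 'M_#|gT| :=
  \matrix_i (if enum_val i \in W then gmul e (gel (enum_val i)) else 0).

Lemma mem_right_ideal g : g \in W -> (gmul e (gel g) <= right_ideal)%MS.
Proof. by move=> Wg; rewrite (sumsmx_sup g) ?genmxE. Qed.

Lemma gel_right_ideal_proj g :
  gel g *m right_ideal_proj = if g \in W then gmul e (gel g) else 0.
Proof. by rewrite -rowE rowK enum_rankK. Qed.

Lemma right_ideal_proj_sub : (right_ideal_proj <= right_ideal)%MS.
Proof.
apply/row_subP=> i; rewrite rowK; case: ifP => [/mem_right_ideal//|_].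
exact: sub0mx.
Qed.

Lemma right_ideal_proj_id : right_ideal *m right_ideal_proj = right_ideal.
Proof.
apply/eqP; rewrite -subr_eq0 -[X in _ - X]mulmx1 -mulmxBr -submx0.
rewrite sumsmxMr; apply/sumsmx_subP=> g Wg; rewrite (eqmxMr _ (genmxE _)).
rewrite submx0 mulmxBr mulmx1 subr_eq0; apply/eqP/coefP=> k.
rewrite coef_gmul_gel -[in RHS]e_idem coef_gmul.
rewrite [gmul e _ in LHS]gel_decomp mulmx_suml summxE.
rewrite (reindex_inj (mulIg g)) /=; apply: eq_bigr => x _.
rewrite -scalemxAl mxE coef_gmul_gel mulgK gel_right_ideal_proj mulrC groupMr //.
case: ifP => [_|/negbT/e_supp->]; last by rewrite !mulr0.
by rewrite coef_gmul_gel invMg mulgA.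
Qed.

Lemma right_ideal_Rg w : w \in W -> stablemx right_ideal (Rg w).
Proof.
move=> Ww; rewrite sumsmxMr; apply/sumsmx_subP=> g Wg.
by rewrite (eqmxMr _ (genmxE _)) gmul_gel_Rg mem_right_ideal ?groupM.
Qed.

Lemma restr_trace_right_ideal w : w \in W ->
  restr_trace right_ideal (Rg w) = \sum_(x in W) coef e (w^-1 ^ x)%g.
Proof.
move=> Ww; rewrite (@restr_trace_retract _ _ _ _ 1%:M right_ideal_proj) ?mulmx1.
- rewrite mxtrace_gel (reindex_inj invg_inj) [RHS]big_mkcond.
  apply: eq_bigr => x _; rewrite mulmxA gel_right_ideal_proj groupV.
  case: ifP => _; last by rewrite mul0mx mxE.
  by rewrite gmul_gel_Rg coef_gmul_gel invMg invgK conjgE mulgA.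
- exact: right_ideal_Rg.
- exact: right_ideal_proj_sub.
exact: right_ideal_proj_id.
Qed.

End RightIdeal.

Definition group_avg H : 'rV[algC]_#|gT| := #|H|%:R^-1 *: \sum_(h in H) gel h.

Lemma coef_group_avg H g : coef (group_avg H) g = #|H|%:R^-1 * (g \in H)%:R.
Proof. by rewrite mxE coef_sum_gel. Qed.

Lemma sum_coef_group_avg H (F : gT -> algC) :
  \sum_g F g * coef (group_avg H) g = #|H|%:R^-1 * \sum_(h in H) F h.
Proof.
rewrite [in RHS]big_mkcond mulr_sumr; apply: eq_bigr => g _.
by rewrite coef_group_avg mulrCA mulr_natr mulrb.
Qed.

Lemma gmul_group_avgr a H :
    {in H, forall h, forall k, coef a (k * h)%g = coef a k} ->
  gmul a (group_avg H) = a.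
Proof.
move=> a_inv; apply: coefP => k; rewrite coef_gmul sum_coef_group_avg.
rewrite (eq_bigr (fun=> coef a k)) => [|h Hh]; last by rewrite a_inv ?groupV.
exact: (@mean_const _ _ algC^o).
Qed.

Lemma gmul_group_avgl a H :
    {in H, forall h, forall k, coef a (h * k)%g = coef a k} ->
  gmul (group_avg H) a = a.
Proof.
move=> a_inv; apply: coefP => k; rewrite coef_gmul.
rewrite (reindex_inj (inj_comp (mulIg k) invg_inj)) /=.
under eq_bigr do rewrite invMg invgK mulKVg mulrC.
rewrite sum_coef_group_avg.
rewrite (eq_bigr (fun=> coef a k)) => [|h Hh]; last by rewrite a_inv ?groupV.
exact: (@mean_const _ _ algC^o).
Qed.

Lemma gmulBl a b e : gmul (a - b) e = gmul a e - gmul b e.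
Proof.
apply: coefP => k; rewrite [RHS]mxE [(- _ : 'rV__) _ _]mxE !coef_gmul -sumrB.
by apply: eq_bigr => y _; rewrite !mxE mulrBl.
Qed.

Lemma gmulBr a b e : gmul e (a - b) = gmul e a - gmul e b.
Proof.
apply: coefP => k; rewrite [RHS]mxE [(- _ : 'rV__) _ _]mxE !coef_gmul -sumrB.
by apply: eq_bigr => y _; rewrite !mxE mulrBr.
Qed.

Lemma group_avgM H K : H \subset K ->
  gmul (group_avg H) (group_avg K) = group_avg K
  /\ gmul (group_avg K) (group_avg H) = group_avg K.
Proof.
move=> /subsetP sHK; split.
  by apply: gmul_group_avgl => h /sHK Kh k; rewrite !coef_group_avg groupMl.
by apply: gmul_group_avgr => h /sHK Kh k; rewrite !coef_group_avg groupMr.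
Qed.

Lemma group_avgB_idem H K : H \subset K ->
  let e := group_avg H - group_avg K in gmul e e = e.
Proof.
move=> sHK; have [[[HK KH] [HH _]] [KK _]] :=
  (group_avgM sHK, group_avgM (subxx H), group_avgM (subxx K)).
by rewrite /= gmulBl !gmulBr HK KH HH KK subrr subr0.
Qed.

Lemma restr_trace_group_avgB H K W w : H \subset K -> K \subset W -> w \in W ->
  restr_trace (right_ideal W (group_avg H - group_avg K)) (Rg w)
    = ('Ind[W, H] 1 - 'Ind[W, K] 1) w.
Proof.
move=> sHK sKW Ww; have coefB g : coef (group_avg H - group_avg K) g =
    #|H|%:R^-1 * (g \in H)%:R - #|K|%:R^-1 * (g \in K)%:R.
  by rewrite mxE [(- _ : 'rV__) _ _]mxE !coef_group_avg.
rewrite restr_trace_right_ideal ?group_avgB_idem // => [|g W'g]; last first.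
  have notin (L : {set gT}) : L \subset W -> (g \in L) = false.
    by move=> /subsetP sLW; apply: contraNF W'g => /sLW.
  by rewrite coefB !notin ?(subset_trans sHK) // !mulr0 subrr.
rewrite !cfunE !cfIndE ?(subset_trans sHK) // !mulr_sumr -sumrB.
by apply: eq_bigr => x _; rewrite coefB !cfun1E conjVg !groupV.
Qed.

End GroupAlgebra.

(** * The Orlik-Solomon relations of three-term circuits *)

Lemma mem_cent1_conj (gT : finGroupType) (x y : gT) :
  (x \in 'C[y]%g) = (x ^ y == x)%g.
Proof. by rewrite cent1E -(inj_eq (mulgI y) (x ^ y)%g) conjgE mulKVg. Qed.

Section OrlikSolomonDegree2.

Variables (gT : finGroupType) (T : {set gT}).
Hypothesis T_gt0 : (0 < #|T|)%N.

Local Notation N := #|{: gT * gT}|.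

Definition circuit_rel (x y z : gT) : 'rV[algC]_N :=
  wedge x z - wedge y z - wedge x y.

Definition wedge_span : 'M[algC]_N :=
  (\sum_(x in T) \sum_(y in T) <<wedge x y>>)%MS.

Definition circuit_span : 'M[algC]_N :=
  (\sum_(x in T) \sum_(y in T) \sum_(z in T) <<circuit_rel x y z>>)%MS.

Lemma wedge_Rp (w x y : gT) : wedge x y *m Rp w = wedge (x ^ w)%g (y ^ w)%g.
Proof.
have pvec_Rp p : pvec p *m Rp w = pvec (p.1 ^ w, p.2 ^ w)%g.
  apply/rowP=> j; rewrite -rowE !mxE eqxx enum_rankK.
  by rewrite -(inj_eq enum_val_inj) enum_rankK.
by rewrite mulmxBl !pvec_Rp.
Qed.

Lemma circuit_rel_Rp (w x y z : gT) :
  circuit_rel x y z *m Rp w = circuit_rel (x ^ w)%g (y ^ w)%g (z ^ w)%g.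
Proof. by rewrite /circuit_rel 2!mulmxBl !wedge_Rp. Qed.

Lemma wedge_span_mulmx_sub j k (M : 'M[algC]_(N, j)) (B : 'M_(k, j)) :
    {in T &, forall x y, (wedge x y *m M <= B)%MS} ->
  (wedge_span *m M <= B)%MS.
Proof.
move=> subB; rewrite sumsmxMr_gen; apply/sumsmx_subP=> x Tx.
rewrite genmxE sumsmxMr_gen; apply/sumsmx_subP=> y Ty.
by rewrite genmxE (eqmxMr _ (genmxE _)) subB.
Qed.

Lemma circuit_span_mulmx_sub j k (M : 'M[algC]_(N, j)) (B : 'M_(k, j)) :
    {in T & &, forall x y z, (circuit_rel x y z *m M <= B)%MS} ->
  (circuit_span *m M <= B)%MS.
Proof.
move=> subB; rewrite sumsmxMr_gen; apply/sumsmx_subP=> x Tx.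
rewrite genmxE sumsmxMr_gen; apply/sumsmx_subP=> y Ty.
rewrite genmxE sumsmxMr_gen; apply/sumsmx_subP=> z Tz.
by rewrite genmxE (eqmxMr _ (genmxE _)) subB.
Qed.

Lemma wedge_in_span : {in T &, forall x y, (wedge x y <= wedge_span)%MS}.
Proof.
move=> x y Tx Ty; apply: (sumsmx_sup x) => //; apply: (sumsmx_sup y) => //.
by rewrite genmxE.
Qed.

Lemma circuit_rel_in_span :
  {in T & &, forall x y z, (circuit_rel x y z <= circuit_span)%MS}.
Proof.
move=> x y z Tx Ty Tz; apply: (sumsmx_sup x) => //.
by apply: (sumsmx_sup y) => //; apply: (sumsmx_sup z); rewrite ?genmxE.
Qed.

(* The differential [a_x a_y |-> a_y - a_x] of the Orlik-Solomon complex and,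
   backwards, left multiplication by the mean of the [a_z]: a contracting
   homotopy, so that together they identify the quotient with the augmentation
   ideal of the permutation module on [T]. *)
Definition OS_diff : 'M[algC]_(N, #|gT|) :=
  \matrix_i (2^-1 *: (gel (enum_val i).2 - gel (enum_val i).1)).

Definition mean_wedge (x : gT) : 'rV[algC]_N :=
  #|T|%:R^-1 *: \sum_(z in T) wedge z x.

Definition OS_homotopy : 'M[algC]_(#|gT|, N) :=
  \matrix_i (if enum_val i \in T then mean_wedge (enum_val i) else 0).

Lemma wedge_OS_diff x y : wedge x y *m OS_diff = gel y - gel x.
Proof.
rewrite mulmxBl -!rowE !rowK !enum_rankK /= -scalerBr opprB addrACA -opprD.
by rewrite -!mulr2n -mulrnBl -scaler_nat scalerA mulVf ?scale1r ?pnatr_eq0.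
Qed.

Lemma gel_OS_homotopy x : x \in T -> gel x *m OS_homotopy = mean_wedge x.
Proof. by move=> Tx; rewrite -rowE rowK enum_rankK Tx. Qed.

Lemma circuit_rel_OS_diff x y z : circuit_rel x y z *m OS_diff = 0.
Proof.
rewrite /circuit_rel 2!mulmxBl !wedge_OS_diff !opprB.
by rewrite [gel z - gel x + _]addrC [_ + (gel z - _)]addrA subrK addrA subrK subrr.
Qed.

Lemma wedge_sub_homotopy x y : x \in T -> y \in T ->
  (wedge x y *m (1%:M - OS_diff *m OS_homotopy) <= circuit_span)%MS.
Proof.
move=> Tx Ty; rewrite mulmxBr mulmx1 mulmxA wedge_OS_diff mulmxBl.
rewrite !gel_OS_homotopy // -[wedge x y](mean_const _ T_gt0) -!scalerBr.
rewrite scalemx_sub // -!sumrB summx_sub // => z Tz.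
suff -> : wedge x y - (wedge z y - wedge z x) = - circuit_rel z x y.
  by rewrite eqmx_opp circuit_rel_in_span.
by rewrite /circuit_rel !opprB addrCA.
Qed.

Lemma mean_wedge_Rp_OS_diff x w : w \in 'N(T)%g ->
  mean_wedge x *m Rp w *m OS_diff = gel (x ^ w)%g - #|T|%:R^-1 *: \sum_(z in T) gel z.
Proof.
move=> nTw; rewrite -2!scalemxAl 2!mulmx_suml.
under eq_bigr do rewrite wedge_Rp wedge_OS_diff.
rewrite sumrB scalerBr mean_const //; congr (_ - _ *: _).
rewrite [RHS](reindex_inj (conjg_inj w)); apply: eq_bigl => z /=.
by rewrite memJ_norm.
Qed.

Lemma mxtrace_OS_homotopy w : w \in 'N(T)%g ->
  \tr (OS_homotopy *m Rp w *m OS_diff) = #|'C_T[w]%g|%:R - 1.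
Proof.
move=> nTw; transitivity (\sum_(x in T) ((x ^ w == x)%g%:R - #|T|%:R^-1 : algC)).
  rewrite mxtrace_gel [RHS]big_mkcond; apply: eq_bigr => x _; rewrite !mulmxA.
  case: ifP => Tx; last by rewrite -rowE rowK enum_rankK Tx !mul0mx mxE.
  rewrite gel_OS_homotopy // mean_wedge_Rp_OS_diff // mxE coef_gel eq_sym.
  by congr (_ + _); rewrite !mxE coef_sum_gel Tx mulr1.
rewrite sumrB sumr_const -[_^-1 *+ _]mulr_natr mulVf ?pnatr_eq0 -?lt0n //.
rewrite -sum_natr_mem; congr (_ - _); apply: eq_bigr => x _.
by rewrite mem_cent1_conj.
Qed.

Lemma quot_trace_circuit_span (U : 'M_N) w :
    (U :=: circuit_span)%MS -> w \in 'N(T)%g ->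
  quot_trace wedge_span U (Rp w) = #|'C_T[w]%g|%:R - 1.
Proof.
move=> eqU nTw; have TJ x : (x ^ w \in T)%g = (x \in T) by apply: memJ_norm.
rewrite (quot_trace_retract (D := OS_diff) (E := OS_homotopy)).
- exact: mxtrace_OS_homotopy.
- rewrite eqU -[circuit_span]mulmx1 circuit_span_mulmx_sub // => x y z Tx Ty Tz.
  rewrite mulmx1; apply: addmx_sub; last by rewrite eqmx_opp wedge_in_span.
  by apply: addmx_sub; rewrite ?eqmx_opp wedge_in_span.
- rewrite eqU (eqmxMr _ eqU) circuit_span_mulmx_sub // => x y z Tx Ty Tz.
  by rewrite circuit_rel_Rp circuit_rel_in_span ?TJ.
- rewrite wedge_span_mulmx_sub // => x y Tx Ty.
  by rewrite wedge_Rp wedge_in_span ?TJ.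
- apply/row_subP=> i; rewrite rowK; case: ifP => [Ti|_]; last exact: sub0mx.
  by rewrite scalemx_sub // summx_sub // => z Tz; rewrite wedge_in_span.
- apply/eqP; rewrite -submx0 (eqmxMr _ eqU) circuit_span_mulmx_sub // => x y z _ _ _.
  by rewrite circuit_rel_OS_diff sub0mx.
by rewrite eqU wedge_span_mulmx_sub // => x y Tx Ty; apply: wedge_sub_homotopy.
Qed.

End OrlikSolomonDegree2.

(** * Dihedral groups *)

Lemma clen_eq (gT : finGroupType) (s t x : gT) n :
    x \in words s t n -> (n <= #|gT|)%N ->
    (forall k, x \in words s t k -> (n <= k)%N) ->
  clen s t x = n.
Proof.
move=> x_n le_n n_min; rewrite /clen; set a := fun k => _.
have a_n : has a (iota 0 #|gT|.+1) by apply/hasP; exists n; rewrite ?mem_iota.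
have := nth_find 0%N a_n; move: (a_n); rewrite has_find size_iota => find_lt.
rewrite nth_iota // add0n => /n_min le_n_find; apply/eqP.
rewrite eqn_leq le_n_find andbT leqNgt; apply/negP=> /(before_find 0%N).
by rewrite nth_iota // /a add0n x_n.
Qed.

Definition dihedral_system (gT : finGroupType) (W : {group gT}) (s t : gT) (m : nat) :=
  [/\ (1 < m)%N, #[s]%g = 2%N, #[t]%g = 2%N, #[s * t]%g = m
    & W :=: <<[set s; t]>>%g].

Definition faithful_reflection_repr (gT : finGroupType) (W : {group gT}) (s t : gT)
    (rho : gT -> 'M[algC]_2) :=
  [/\ mx_repr W rho, {in W &, injective rho},
      \rank (rho s - 1%:M) = 1%N & \rank (rho t - 1%:M) = 1%N].

Section Dihedral.

Variables (gT : finGroupType) (W : {group gT}) (s t : gT) (m : nat).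
Hypothesis dihW : dihedral_system W s t m.

Local Notation r := (s * t)%g.
Local Notation rot := <[(s * t)%g]>%g.
Local Notation T := (refls s t W).

Local Open Scope group_scope.

Let m_gt1 : (1 < m)%N. Proof. by case: dihW. Qed.
Let order_r : #[r] = m. Proof. by case: dihW. Qed.
Let defW : W :=: <<[set s; t]>>. Proof. by case: dihW. Qed.
Let order_s : #[s] = 2%N. Proof. by case: dihW. Qed.
Let order_t : #[t] = 2%N. Proof. by case: dihW. Qed.
Let mulss : s * s = 1. Proof. by rewrite -expg2 -order_s expg_order. Qed.
Let multt : t * t = 1. Proof. by rewrite -expg2 -order_t expg_order. Qed.
Let sV : s^-1 = s. Proof. by apply/eqP; rewrite eq_invg_mul mulss. Qed.
Let tV : t^-1 = t. Proof. by apply/eqP; rewrite eq_invg_mul multt. Qed.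
Let mulsK x : x * s * s = x. Proof. by rewrite -mulgA mulss mulg1. Qed.
Let mulsr : s * r = t. Proof. by rewrite mulgA mulss mul1g. Qed.

Let s_in_W : s \in W. Proof. by rewrite defW mem_gen ?inE ?eqxx. Qed.
Let t_in_W : t \in W. Proof. by rewrite defW mem_gen ?inE ?eqxx ?orbT. Qed.

Lemma rot_sub_W : rot \subset W.
Proof. by rewrite cycle_subG groupM. Qed.

Let rot_in_W x : x \in rot -> x \in W. Proof. exact: subsetP rot_sub_W x. Qed.

Lemma conj_rot_s x : x \in rot -> x ^ s = x^-1.
Proof.
case/cycleP=> k ->; rewrite conjXg -expgVn; congr (_ ^+ k).
by rewrite conjgE invMg sV tV !mulgA mulss mul1g.
Qed.

Lemma s_notin_rot : s \notin rot.
Proof.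
apply/negP=> rot_s; have rV : r^-1 = r.
  rewrite -conj_rot_s ?cycle_id //; apply/conjg_fixP/commgP.
  by apply: (centsP (cycle_abelian r)) (cycle_id r) _ rot_s.
have /cycle2g def_rot : #[r] = 2%N.
  apply: nt_prime_order => //; last by rewrite -order_gt1 order_r.
  by rewrite expg2 -{1}rV mulVg.
move: rot_s; rewrite def_rot !inE -order_eq1 order_s /= => /eqP srE.
suff t1 : t = 1 by move: order_t; rewrite t1 order1.
by apply: (mulgI s); rewrite mulg1 -srE.
Qed.

Lemma rot_norms : W \subset 'N(rot).
Proof.
have nrot_s : s \in 'N(rot).
  by rewrite inE; apply/subsetP=> _ /imsetP[x rx ->]; rewrite conj_rot_s ?groupV.
have nrot_r : r \in 'N(rot) by rewrite (subsetP (normG _)) ?cycle_id.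
rewrite defW gen_subG subUset !sub1set nrot_s.
by have := groupM nrot_s nrot_r; rewrite mulsr.
Qed.

Lemma conj_in_rot x y : y \in W -> (x ^ y \in rot) = (x \in rot).
Proof. by move=> Wy; rewrite memJ_norm // (subsetP rot_norms). Qed.

Lemma W_rcosets : W :=: rot :|: rot :* s.
Proof.
have Wgroup : rot <*> <[s]> = rot * <[s]>.
  by rewrite norm_joinEr // cycle_subG (subsetP rot_norms).
have -> : W :=: rot * <[s]>.
  apply/eqP; rewrite eqEsubset mul_subG ?rot_sub_W ?cycle_subG // andbT.
  have gen_s : s \in rot <*> <[s]> by rewrite mem_gen // inE cycle_id orbT.
  have gen_r : r \in rot <*> <[s]> by rewrite mem_gen // inE cycle_id.
  rewrite defW -Wgroup gen_subG subUset !sub1set gen_s.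
  by have := groupM gen_s gen_r; rewrite mulsr.
by rewrite (cycle2g order_s) mulgU mulg1.
Qed.

Lemma mem_W x : (x \in W) = (x \in rot) || (x * s \in rot).
Proof. by rewrite W_rcosets inE mem_rcoset sV. Qed.

Lemma mul_s_in_rot x : x \in W -> (x * s \in rot) = (x \notin rot).
Proof.
rewrite mem_W; have [rx _|] //= := boolP (x \in rot).
by rewrite groupMl // (negPf s_notin_rot).
Qed.

Lemma conj_rot x y : x \in rot -> y \in W -> x ^ y = if y \in rot then x else x^-1.
Proof.
move=> rx Wy; have rot_fix u : u \in rot -> x ^ u = x.
  by move=> ru; apply/conjg_fixP/commgP/(centsP (cycle_abelian r)).
case: ifPn => [/rot_fix//|]; rewrite -mul_s_in_rot // => /rot_fix xysE.
by rewrite -[y]mulsK conjgM xysE conj_rot_s.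
Qed.

Lemma refl_mulxx x : x \in W -> x \notin rot -> x * x = 1.
Proof.
move=> Wx r'x; have rot_xs : x * s \in rot by rewrite mul_s_in_rot.
rewrite -[x]mulsK; set u := x * s in rot_xs *.
have -> : u * s * (u * s) = u * u ^ s by rewrite conjgE sV !mulgA.
by rewrite conj_rot_s ?mulgV.
Qed.

Lemma refl_inv x : x \in W -> x \notin rot -> x^-1 = x.
Proof. by move=> Wx r'x; apply/eqP; rewrite eq_invg_mul refl_mulxx. Qed.

Lemma mem_rotM x y : x \in W -> y \in W ->
  (x * y \in rot) = ((x \in rot) == (y \in rot)).
Proof.
move=> Wx Wy; have [rx|r'x] := boolP (x \in rot); first by rewrite groupMl.
have [ry|r'y] := boolP (y \in rot); first by rewrite groupMr ?(negPf r'x).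
rewrite -[x]mulsK -mulgA groupMl ?mul_s_in_rot //.
by rewrite -groupV invMg sV refl_inv // mul_s_in_rot.
Qed.

Lemma card_W : #|W| = m.*2.
Proof.
rewrite W_rcosets cardsU card_rcoset -orderE order_r addnn.
suff -> : rot :&: rot :* s = set0 by rewrite cards0 subn0.
apply/setP=> x; rewrite !inE mem_rcoset sV; apply/negP=> /andP[rx].
by rewrite mul_s_in_rot ?rx ?rot_in_W.
Qed.

(** * Coxeter length *)

(* The Cayley graph of [W] is a cycle with [m.*2] vertices, and [alt_word c] is
   its [c]-th vertex: the alternating word [s t s ...] of length [c], or, going
   round the other way, the word [t s t ...] of length [m.*2 - c]. *)
Definition alt_word (c : nat) : gT := r ^+ c./2 * s ^+ odd c.

Lemma alt_word_W c : alt_word c \in W.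
Proof. by rewrite groupM ?groupX ?groupM. Qed.

Lemma alt_word_in_rot c : (alt_word c \in rot) = ~~ odd c.
Proof.
rewrite groupMl ?mem_cycle //; case: odd; last by rewrite group1.
by rewrite expg1 (negPf s_notin_rot).
Qed.

Lemma alt_word0 : alt_word 0 = 1.
Proof. by rewrite /alt_word /= !expg0 mulg1. Qed.

Lemma alt_word_period c : alt_word (c + m.*2) = alt_word c.
Proof.
rewrite /alt_word oddD odd_double addbF halfD odd_double andbF add0n doubleK.
by rewrite expgD -order_r expg_order mulg1.
Qed.

Lemma alt_word_double_m : alt_word m.*2 = 1.
Proof. by rewrite -[m.*2]add0n alt_word_period alt_word0. Qed.

Lemma alt_word_inj : {in gtn m.*2 &, injective alt_word}.
Proof.
move=> c d; rewrite !inE => lt_c lt_d eq_cd.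
have eq_odd : odd c = odd d by apply: negb_inj; rewrite -!alt_word_in_rot eq_cd.
have /eqP : r ^+ c./2 = r ^+ d./2 by move: eq_cd; rewrite /alt_word eq_odd => /mulIg.
rewrite eq_expg_mod_order order_r !modn_small; lia.
Qed.

Lemma alt_word_mod c : alt_word (c %% m.*2) = alt_word c.
Proof.
rewrite {2}(divn_eq c m.*2) addnC; elim: (c %/ m.*2)%N => [|k IHk].
  by rewrite addn0.
by rewrite mulSnr addnA alt_word_period.
Qed.

Lemma alt_word_eq c d : (c < d + m.*2.*2)%N -> (d < c + m.*2.*2)%N ->
  (alt_word c == alt_word d) = [|| c == d, c == d + m.*2 | d == c + m.*2]%N.
Proof.
wlog le_cd : c d / (c <= d)%N => [le_case lt_cd lt_dc|_ lt_dc].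
  have [/le_case-> //|/ltnW/le_case eq_dc] := leqP c d.
  by rewrite eq_sym eq_dc // eq_sym orbCA orbC -orbA.
have mod_lt k : (k %% m.*2 < m.*2)%N by rewrite ltn_mod; lia.
rewrite -alt_word_mod -[alt_word d]alt_word_mod (inj_in_eq alt_word_inj) ?inE //.
rewrite eq_sym eqn_mod_dvd //; apply/dvdnP/idP=> [[[|[|k]]]|]; try lia.
case/or3P=> /eqP dE; [exists 0%N | exists 1%N | exists 1%N]; lia.
Qed.

Lemma W_alt_words : W :=: [set alt_word c | c : 'I_m.*2].
Proof.
apply/esym/eqP; rewrite eqEcard card_W card_imset ?card_ord ?leqnn ?andbT.
  by apply/subsetP=> _ /imsetP[c _ ->]; apply: alt_word_W.
by move=> c d /(alt_word_inj (ltn_ord c) (ltn_ord d))/val_inj.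
Qed.

Lemma alt_wordP x : x \in W -> exists2 c, (c < m.*2)%N & x = alt_word c.
Proof. by rewrite W_alt_words => /imsetP[c _ ->]; exists c. Qed.

Lemma rot_expV k : (k <= m)%N -> (r ^+ k)^-1 = r ^+ (m - k).
Proof.
by move=> le_km; apply/eqP; rewrite eq_invg_mul -expgD subnKC // -order_r expg_order.
Qed.

Lemma mul_s_alt_word c : (c <= m.*2.+1)%N -> s * alt_word c = alt_word (m.*2.+1 - c).
Proof.
move=> le_c; have -> : s * alt_word c = (r ^+ c./2)^-1 * s ^+ (~~ odd c).
  rewrite -conj_rot_s ?mem_cycle // conjgE sV /alt_word.
  by case: odd; rewrite ?expg0 ?expg1 !mulgA ?mulsK ?mulg1.
rewrite rot_expV; last lia.
by rewrite /alt_word; congr (_ ^+ _ * _ ^+ nat_of_bool _); lia.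
Qed.

Lemma mul_t_alt_word c : (c < m.*2)%N -> t * alt_word c = alt_word (m.*2.-1 - c).
Proof.
move=> lt_c; have -> : (m.*2.-1 - c = m.*2.+1 - c.+2)%N by lia.
rewrite -mul_s_alt_word; last lia.
by rewrite /alt_word /= negbK expgS !mulgA mulss mul1g.
Qed.

Lemma alt_wordS c : alt_word c.+1 = alt_word c * (if odd c then t else s).
Proof.
rewrite /alt_word /= uphalf_half; case: odd => /=; last by rewrite expg0 mulg1.
by rewrite expg0 expg1 mulg1 -mulgA expgSr.
Qed.

Lemma alt_word_pred c : alt_word c = alt_word c.+1 * (if odd c then t else s).
Proof. by rewrite alt_wordS -mulgA; case: odd; rewrite ?mulss ?multt mulg1. Qed.

Lemma letter_in_Sset (b : bool) : (if b then t else s) \in Sset s t.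
Proof. by case: b; rewrite !inE eqxx ?orbT. Qed.

Lemma words_rcons n x a :
  x \in words s t n -> a \in Sset s t -> x * a \in words s t n.+1.
Proof.
have wordsE k : words s t k = Sset s t ^+ k by elim: k => //= k ->; rewrite expgS.
by rewrite !wordsE expgSr => xn Sa; apply: mem_mulg.
Qed.

Lemma alt_word_words c : alt_word c \in words s t c.
Proof.
elim: c => [|c IHc]; first by rewrite alt_word0 inE.
by rewrite alt_wordS words_rcons ?letter_in_Sset.
Qed.

Lemma alt_word_sub_words c : (c <= m.*2)%N -> alt_word (m.*2 - c) \in words s t c.
Proof.
elim: c => [_|c IHc lt_c]; first by rewrite subn0 alt_word_double_m inE.
rewrite alt_word_pred -subSn // subSS words_rcons ?letter_in_Sset ?IHc //.
exact: ltnW.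
Qed.

Lemma words_alt_word n x : x \in words s t n ->
  exists c, [/\ (c <= m.*2)%N, x = alt_word c & (c <= n)%N || (m.*2 <= c + n)%N].
Proof.
elim: n x => [x|n IHn _ /mulsgP[a x Sa /IHn[c [le_c -> near0]] ->]].
  by rewrite inE => /eqP->; exists 0%N; rewrite alt_word0.
case/set2P: Sa => ->.
  have [->|c_gt0] := posnP c.
    by exists 1%N; split; [lia | rewrite alt_wordS alt_word0 mulg1 mul1g | lia].
  by exists (m.*2.+1 - c)%N; split; [lia | rewrite mul_s_alt_word //; lia | lia].
have [->|c_neq] := eqVneq c m.*2.
  exists m.*2.-1; split; [lia | | lia].
  by rewrite alt_word_double_m -alt_word0 mul_t_alt_word ?subn0 //; lia.
by exists (m.*2.-1 - c)%N; split; [lia | rewrite mul_t_alt_word //; lia | lia].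
Qed.

Lemma clen_alt_word c : (c < m.*2)%N -> clen s t (alt_word c) = minn c (m.*2 - c).
Proof.
move=> lt_c; apply: clen_eq => [||n /words_alt_word[d [le_d eq_cd near0]]].
- rewrite /minn; case: ifP => _; first exact: alt_word_words.
  by rewrite -{1}(subKn (ltnW lt_c)) alt_word_sub_words // leq_subr.
- by rewrite (leq_trans _ (max_card (mem W))) // card_W; lia.
by move/eqP: eq_cd; rewrite alt_word_eq; lia.
Qed.

Lemma sgnSE x : x \in W -> sgnS s t x = ((-1) ^+ (x \notin rot))%R.
Proof.
case/alt_wordP=> c lt_c ->; rewrite /sgnS clen_alt_word // alt_word_in_rot negbK.
by rewrite -signr_odd; congr (_ ^+ nat_of_bool _)%R; lia.
Qed.

Lemma sgnS_lin_char : {eps : 'CF(W) | eps \is a linear_char & {in W, eps =1 sgnS s t}}.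
Proof.
apply: lin_char_of_morph => [|x y Wx Wy]; first by rewrite sgnSE ?group1.
rewrite !sgnSE ?(groupM Wx Wy) // mem_rotM // -signr_addb.
by case: (x \in rot) (y \in rot) => [] [].
Qed.

Lemma longestE : longest s t W = alt_word m.
Proof.
rewrite /longest; case: arg_maxnP => [|w /alt_wordP[c lt_c ->] clen_max].
  exact: group1.
have := clen_max _ (alt_word_W m).
by rewrite !clen_alt_word // => [le_mc|]; [congr alt_word|]; lia.
Qed.

Local Notation w0 := (alt_word m).

Let w0_W : w0 \in W. Proof. exact: alt_word_W. Qed.

Lemma s_neq_t : s != t.
Proof. by apply: contraTneq m_gt1 => st; rewrite -order_r -st mulss order1. Qed.

Lemma eq_set_alt_word (A B : {set gT}) : A \subset W -> B \subset W ->
  (forall c, (c < m.*2)%N -> (alt_word c \in A) = (alt_word c \in B)) -> A = B.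
Proof.
move=> /subsetP sAW /subsetP sBW eqAB; apply/setP=> x.
have [/alt_wordP[c lt_c ->]|W'x] := boolP (x \in W); first exact: eqAB.
by rewrite (contraNF (sAW x) W'x) (contraNF (sBW x) W'x).
Qed.

(** * Descents and the idempotent [e_S] *)

Lemma Xset_sub J : Xset s t W J \subset W.
Proof. by apply/subsetP=> x; rewrite inE => /andP[]. Qed.

Lemma mem_Xset_set1 a x :
  (x \in Xset s t W [set a]) = (x \in W) && (clen s t x < clen s t (a * x))%N.
Proof.
rewrite inE; congr (_ && _).
by apply/forall_inP/idP=> [|lt_x b /set1P-> //]; apply; rewrite set11.
Qed.

Lemma mem_Xset_s c : (c < m.*2)%N ->
  (alt_word c \in Xset s t W [set s]) = (c == 0)%N || (m < c)%N.
Proof.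
move=> lt_c; rewrite mem_Xset_set1 alt_word_W mul_s_alt_word; last lia.
have [->|c_gt0] := posnP c.
  by rewrite subn0 -[m.*2.+1]add1n alt_word_period !clen_alt_word //; lia.
have [->|c_neq1] := eqVneq c 1%N.
  by rewrite subSS subn0 alt_word_double_m -alt_word0 !clen_alt_word //; lia.
rewrite !clen_alt_word; lia.
Qed.

Lemma mem_Xset_t c : (c < m.*2)%N ->
  (alt_word c \in Xset s t W [set t]) = (c < m)%N.
Proof.
move=> lt_c.
by rewrite mem_Xset_set1 alt_word_W mul_t_alt_word // !clen_alt_word; lia.
Qed.

Lemma Xset0 : Xset s t W set0 = W.
Proof.
apply/setP=> x; rewrite inE; case: (x \in W) => //=.
by apply/forall_inP=> a; rewrite inE.
Qed.

Lemma Xset_setI : Xset s t W [set s] :&: Xset s t W [set t] = [set 1].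
Proof.
apply: eq_set_alt_word; rewrite ?subIset ?Xset_sub ?sub1set ?group1 // => c lt_c.
rewrite inE mem_Xset_s // mem_Xset_t // in_set1 -alt_word0 alt_word_eq; lia.
Qed.

Lemma Xset_setU : Xset s t W [set s] :|: Xset s t W [set t] = W :\ w0.
Proof.
apply: eq_set_alt_word; rewrite ?subUset ?Xset_sub ?subD1set // => c lt_c.
rewrite inE mem_Xset_s // mem_Xset_t // in_setD1 alt_word_W alt_word_eq; lia.
Qed.

Lemma Xset_Sset : Xset s t W (Sset s t) = [set 1].
Proof.
rewrite -Xset_setI; apply/setP=> x; rewrite [in RHS]inE !mem_Xset_set1 inE.
case: (x \in W) => //=; apply/forall_inP/andP=> [asc | [lt_s lt_t] a /set2P[] -> //].
by rewrite !asc ?inE ?eqxx ?orbT.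
Qed.

Lemma conj_alt_word_Sset a c :
  (a ^ alt_word c \in Sset s t) =
    (a * alt_word c == alt_word c.+1) || (a * alt_word c == alt_word (c + m.*2).-1).
Proof.
have -> : alt_word (c + m.*2).-1 = alt_word c * (if odd c then s else t).
  have [k ck] : exists k, (c + m.*2 = k.+1)%N by exists (c + m.*2).-1; lia.
  rewrite -(alt_word_period c) ck [LHS]alt_word_pred.
  have -> : odd k = ~~ odd c by lia.
  by case: (odd c).
have conjE b : (a ^ alt_word c == b) = (a * alt_word c == alt_word c * b).
  by rewrite -(inj_eq (mulgI (alt_word c))) conjgE mulKVg.
by rewrite alt_wordS !inE !conjE; case: odd; rewrite // orbC.
Qed.

(* In the Cayley cycle, [a] acts as a reflection fixing two opposite edges. *)
Lemma Xsharp_set1 a : a \in Sset s t -> Xsharp s t W [set a] = [set 1; a * w0].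
Proof.
have sW b : b \in W -> [set 1; b * w0] \subset W.
  by move=> Wb; rewrite subUset !sub1set group1 groupM.
have sXW b : Xsharp s t W [set b] \subset W.
  by apply: subset_trans (Xset_sub [set b]); apply/subsetP=> x; rewrite inE => /andP[].
case/set2P=> ->; apply: eq_set_alt_word; rewrite ?sW ?sXW // => c lt_c.
  rewrite inE mem_Xset_s // conjg_set1 sub1set conj_alt_word_Sset !inE -alt_word0.
  rewrite !mul_s_alt_word ?alt_word_eq; lia.
rewrite inE mem_Xset_t // conjg_set1 sub1set conj_alt_word_Sset !inE -alt_word0.
rewrite !mul_t_alt_word ?alt_word_eq; lia.
Qed.

Lemma w0_inv : w0^-1 = w0.
Proof.
have [m_odd|m_even] := boolP (odd m).
  by rewrite refl_inv // alt_word_in_rot m_odd.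
rewrite /alt_word (negPf m_even) expg0 mulg1 rot_expV; last lia.
by congr (_ ^+ _); lia.
Qed.

Lemma order_w0 : #[w0] = 2%N.
Proof.
apply: nt_prime_order; rewrite // ?expg2; first by rewrite -{1}w0_inv mulVg.
by rewrite -alt_word0 alt_word_eq; lia.
Qed.

Lemma mKL_set0 K : mKL s t W K set0 = #|Xset s t W K|.
Proof.
have Xsharp0 : Xsharp s t W set0 = W.
  by apply/setP=> x; rewrite inE Xset0 conj0g sub0set andbT.
by rewrite /mKL sub0set Xsharp0 (setIidPl (Xset_sub K)).
Qed.

Lemma mKL_set1 a : a \in Sset s t -> mKL s t W [set a] [set a] = 2%N.
Proof.
move=> Sa; 
have /setIidPr sXX : Xsharp s t W [set a] \subset Xset s t W [set a].
  by apply/subsetP=> x; rewrite inE => /andP[].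
rewrite /mKL subxx sXX Xsharp_set1 // cards2; suff -> : 1 != a * w0 by [].
rewrite -alt_word0; case/set2P: Sa => ->.
  by rewrite mul_s_alt_word ?alt_word_eq; lia.
by rewrite mul_t_alt_word ?alt_word_eq; lia.
Qed.

Lemma mKL_Sset (L : {set gT}) : L \subset Sset s t -> mKL s t W (Sset s t) L = 1%N.
Proof.
move=> sLS; rewrite /mKL sLS Xset_Sset (setIidPl _) ?cards1 // sub1set inE conjsg1 sLS.
rewrite andbT inE group1; apply/forall_inP=> a /(subsetP sLS) Sa.
have : 1 \in Xset s t W (Sset s t) by rewrite Xset_Sset set11.
by rewrite inE group1 => /forall_inP->.
Qed.

Lemma proper_set1 (a : gT) (L : {set gT}) : (L \proper [set a]) = (L == set0).
Proof.
rewrite properEcard cards1 ltnS leqn0 cards_eq0.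
by apply: andb_idl => /eqP->; apply: sub0set.
Qed.

Lemma proper_Sset (L : {set gT}) :
  (L \proper Sset s t) = (L \in [set set0; [set s]; [set t]]).
Proof.
rewrite properEcard cards2 s_neq_t !inE.
apply/andP/idP=> [[sLS]|]; last first.
  by case/orP=> [/orP[]|] /eqP->;
    rewrite ?sub0set ?sub1set ?cards0 ?cards1 ?inE ?eqxx ?orbT.
rewrite ltnS leq_eqVlt ltnS leqn0 cards_eq0 => /orP[/cards1P[x defL]|->//].
have /set2P[] : x \in Sset s t by rewrite -sub1set -defL.
  by rewrite defL => ->; rewrite eqxx orbT.
by rewrite defL => ->; rewrite eqxx !orbT.
Qed.

Lemma sum_proper_Sset (V : nmodType) (F : {set gT} -> V) :
  (\sum_(L : {set gT} | L \proper Sset s t) F L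
    = F set0 + F [set s] + F [set t])%R.
Proof.
have set1_neq0 (x : gT) : (set0 == [set x]) = false by rewrite eq_sym -cards_eq0 cards1.
rewrite (eq_bigl _ _ proper_Sset) setUC big_setU1 ?big_setU1 ?big_set1 /=.
- by rewrite addrC.
- by rewrite inE set1_neq0.
by rewrite !inE eq_sym set1_neq0 (inj_eq set1_inj) eq_sym (negPf s_neq_t).
Qed.

Local Open Scope ring_scope.

Lemma eaux_set0 k : eaux s t W k set0 = group_avg W.
Proof.
have -> : group_avg W = (mKL s t W set0 set0)%:R^-1 *: xK s t W set0.
  rewrite mKL_set0 Xset0 /group_avg /xK Xset0 (reindex_inj invg_inj).
  by congr (_ *: _); apply: eq_bigl => x; rewrite groupV.
case: k => [|k] /=; rewrite ?subr0 // big_pred0 ?subr0 // => L.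
by rewrite properE sub0set andbF.
Qed.

Lemma eaux_set1 k a : a \in Sset s t ->
  eaux s t W k.+1 [set a] =
    2^-1 *: (xK s t W [set a] - #|Xset s t W [set a]|%:R *: group_avg W).
Proof.
move=> Sa.
by rewrite /= mKL_set1 // (eq_bigl _ _ (proper_set1 a)) big_pred1_eq mKL_set0 eaux_set0.
Qed.

Lemma xK_s_add_t :
  xK s t W [set s] + xK s t W [set t] = #|W|%:R *: group_avg W + gel 1%g - gel w0.
Proof.
have sumW : #|W|%:R *: group_avg W = \sum_(x in W) gel x^-1%g.
  rewrite scalerA divff ?neq0CG // scale1r (reindex_inj invg_inj).
  by apply: eq_bigl => x; rewrite groupV.
rewrite sumW (big_setD1 w0) //= w0_inv /xK sum_setUI Xset_setU Xset_setI.
by rewrite big_set1 invg1 addrAC [gel w0 + _]addrC addrK.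
Qed.

Lemma group_avg_w0 : group_avg <[w0]> = 2^-1 *: (gel 1%g + gel w0).
Proof.
rewrite /group_avg -orderE order_w0 /= (cycle2g order_w0) big_setU1 ?big_set1 //.
by rewrite inE eq_sym -order_eq1 order_w0.
Qed.

(* [x_s + x_t] runs over [W] without [w0], and hits [1] twice. *)
Lemma eL_Sset : eL s t W (Sset s t) = group_avg <[w0]> - group_avg W.
Proof.
have -> : eL s t W (Sset s t) = (mKL s t W (Sset s t) (Sset s t))%:R^-1 *:
    (xK s t W (Sset s t) - \sum_(L : {set gT} | L \proper Sset s t)
       (mKL s t W (Sset s t) L)%:R *: eaux s t W 1 L).
  by rewrite /eL cards2 s_neq_t.
have [Ss St] : s \in Sset s t /\ t \in Sset s t by rewrite !inE !eqxx orbT.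
rewrite sum_proper_Sset !mKL_Sset ?sub0set ?sub1set ?subxx //.
rewrite invr1 !scale1r eaux_set0 !eaux_set1 // group_avg_w0.
have -> : xK s t W (Sset s t) = gel 1%g by rewrite /xK Xset_Sset big_set1 invg1.
have card_XX : #|Xset s t W [set s]|%:R = #|W|%:R - #|Xset s t W [set t]|%:R :> algC.
  apply/eqP; rewrite eq_sym subr_eq -natrD -cardsUI Xset_setU Xset_setI cards1.
  by rewrite addnC [#|W|](cardsD1 w0) w0_W.
have := xK_s_add_t; move/(canRL (addrK _)) ->; rewrite card_XX.
apply/rowP=> i; rewrite !mxE; field; exact: neq0CG.
Qed.

Lemma Phi_S_Ind x : x \in W -> Phi_S s t W x = ('Ind[W, <[w0]>] 1 - 1) x.
Proof.
move=> Wx; rewrite /Phi_S /eSCW eL_Sset restr_trace_group_avgB ?cycle_subG //.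
by rewrite cfInd_id.
Qed.

(** * Conjugacy and the values of [Phi_S] *)

Lemma rot_sqr_eq1 x : x \in rot -> (x * x == 1)%g = (x \in <[w0]>)%g.
Proof.
case/cyclePmin=> k; rewrite order_r => lt_k ->; rewrite (cycle2g order_w0) !inE.
have <- : alt_word k.*2 = (r ^+ k)%g by rewrite /alt_word odd_double doubleK mulg1.
have -> : (alt_word k.*2 * alt_word k.*2 = alt_word k.*2.*2)%g.
  by rewrite /alt_word !odd_double !mulg1 -expgD addnn !doubleK.
rewrite -alt_word0 !alt_word_eq; lia.
Qed.

Lemma rotX_s_class k : (r ^+ k * s \in (if odd k then t else s) ^: W)%g.
Proof.
have rkV i : (r ^+ i * s = s * (r ^+ i)^-1)%g.
  by rewrite -[in RHS]conj_rot_s ?mem_cycle // conjgE sV !mulgA mulss mul1g.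
have Wr i : (r ^+ i \in W)%g by rewrite groupX ?groupM.
have [k_odd|k_even] := boolP (odd k).
  suff -> : (r ^+ k * s = t ^ (r ^+ k./2.+1)^-1)%g by rewrite memJ_class ?groupV.
  have t_rkV : (t * (r ^+ k./2.+1)^-1 = r ^+ k./2 * s)%g.
    by rewrite rkV expgSr invMg -{1}mulsr -mulgA mulKVg.
  rewrite conjgE invgK t_rkV mulgA -expgD; congr (_ ^+ _ * _)%g; lia.
suff -> : (r ^+ k * s = s ^ (r ^+ k./2)^-1)%g by rewrite memJ_class ?groupV.
rewrite conjgE invgK -rkV mulgA -expgD; congr (_ ^+ _ * _)%g; lia.
Qed.

Lemma reflsE : T = W :\: rot.
Proof.
have r't : t \notin rot.
  by have := s_notin_rot; rewrite -(groupMr s (cycle_id r)) mulsr.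
apply/setP=> x; rewrite in_setD andbC; apply/idP/andP=> [|[Wx r'x]].
  rewrite inE => /orP[] /imsetP[y Wy ->]; rewrite groupJ // conj_in_rot //.
  by rewrite s_notin_rot.
have /cycleP[k xsE] : (x * s)%g \in rot by rewrite mul_s_in_rot.
have := rotX_s_class k; rewrite -xsE mulsK inE.
by case: (odd k) => ->; rewrite ?orbT.
Qed.

Lemma in_refls x : (x \in T) = (x \in W) && (x \notin rot).
Proof. by rewrite reflsE in_setD andbC. Qed.

Lemma refl_in_W a : a \in T -> a \in W.
Proof. by rewrite in_refls => /andP[]. Qed.

Lemma refl_conj_rot a u : a \in T -> u \in rot -> (u ^ a = u^-1)%g.
Proof. by rewrite in_refls => /andP[Wa /negPf r'a] ru; rewrite conj_rot // r'a. Qed.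

Lemma card_refls : #|T| = m.
Proof.
by rewrite reflsE cardsD (setIidPr rot_sub_W) card_W -orderE order_r -addnn addnK.
Qed.

Lemma refls_norms : W \subset 'N(T).
Proof.
apply/subsetP=> w Ww; rewrite inE; apply/subsetP=> _ /imsetP[a Ta ->].
by move: Ta; rewrite !in_refls groupJr // conj_in_rot.
Qed.

Lemma cent1_refls_rot x : x \in rot -> 'C_T[x]%g = if (x * x == 1)%g then T else set0.
Proof.
move=> rx; rewrite -eq_invg_mul; apply/setP=> a; rewrite in_setI.
case Ta: (a \in T) => /=.
  by rewrite cent1C mem_cent1_conj refl_conj_rot //; case: ifP; rewrite ?Ta ?inE.
by case: ifP; rewrite ?Ta ?inE.
Qed.

Lemma card_cent1_rot_refl a : a \in T -> #|'C_rot[a]%g| = (~~ odd m).+1.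
Proof.
move=> Ta; have -> : 'C_rot[a]%g = rot :&: <[w0]>%g.
  apply/setP=> u; rewrite !in_setI; case ru: (u \in rot) => //=.
  by rewrite mem_cent1_conj refl_conj_rot // eq_invg_mul rot_sqr_eq1.
have [m_odd|m_even] := boolP (odd m).
  have -> : rot :&: <[w0]>%g = [set 1%g].
    rewrite (cycle2g order_w0); apply/setP=> u; rewrite !inE.
    have [->|_ /=] := eqVneq u 1%g; first by rewrite group1.
    by apply/andP=> -[ru /eqP uE]; rewrite uE alt_word_in_rot m_odd in ru.
  by rewrite cards1.
by rewrite (setIidPr _) -?orderE ?order_w0 // cycle_subG alt_word_in_rot m_even.
Qed.

Lemma card_cent1_refls_refl a : a \in T -> #|'C_T[a]%g| = (~~ odd m).+1.
Proof.
move=> Ta; move: (Ta); rewrite in_refls => /andP[Wa r'a].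
rewrite -(card_cent1_rot_refl Ta) -(card_rcoset _ a); apply: eq_card => x.
rewrite mem_rcoset refl_inv // !in_setI reflsE in_setD.
rewrite (groupMr _ (cent1id a)).
case: (x \in 'C[a]%g); rewrite ?andbF // !andbT.
rewrite (groupMr x Wa) andbC; have [Wx|W'x] := boolP (x \in W).
  by rewrite mem_rotM // (negPf r'a); case: (x \in rot).
by apply/esym/(contraNF _ W'x)/rot_in_W.
Qed.

Lemma card_cent1_refl a : a \in T -> #|'C_W[a]%g| = (~~ odd m).+1.*2.
Proof.
move=> Ta; rewrite -(cardsID rot) setIAC (setIidPr rot_sub_W) card_cent1_rot_refl //.
by rewrite -setIDAC -reflsE card_cent1_refls_refl // addnn.
Qed.

Lemma refl_class_odd a : odd m -> a \in T -> (a ^: W = T)%g.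
Proof.
move=> m_odd Ta; apply/eqP; rewrite eqEcard class_sub_norm ?refls_norms // Ta.
rewrite card_refls -index_cent1 -divgS ?subsetIl // card_W card_cent1_refl // m_odd.
by rewrite -!muln2 mul1n mulnK ?leqnn.
Qed.

Lemma cfInd_w0_rot x : x \in rot ->
  'Ind[W, <[w0]>] 1 x = m%:R * (x * x == 1)%g%:R.
Proof.
move=> rx; rewrite cfIndE ?cycle_subG //.
rewrite (eq_bigr (fun=> (x * x == 1)%g%:R)) => [|y Wy].
  rewrite sumr_const card_W -orderE order_w0 -muln2 mulrnA mulr_natl.
  by rewrite -[_ *+ m *+ 2]mulr_natl mulKf ?pnatr_eq0.
rewrite cfun1E -rot_sqr_eq1 ?conj_in_rot // -conjMg.
by rewrite -[X in _ == X](conj1g y) (inj_eq (conjg_inj y)).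
Qed.

Lemma cfInd_w0_refl x : x \in T -> 'Ind[W, <[w0]>] 1 x = (odd m)%:R.
Proof.
move=> Tx; move: (Tx); rewrite in_refls => /andP[Wx r'x].
have [m_odd|m_even] := boolP (odd m); last first.
  rewrite cfIndE ?cycle_subG // big1 ?mulr0 // => y Wy; rewrite cfun1E.
  have [xy_w0|//] := boolP (x ^ y \in _)%g.
  case/negP: r'x; rewrite -(conj_in_rot _ Wy) (subsetP _ _ xy_w0) // cycle_subG.
  by rewrite alt_word_in_rot m_even.
have Tw0 : w0 \in T by rewrite in_refls w0_W alt_word_in_rot m_odd.
have /imsetP[y Wy ->] : x \in (w0 ^: W)%g by rewrite refl_class_odd.
rewrite cfunJ // cfIndE ?cycle_subG // -orderE order_w0.
rewrite (eq_bigr (fun u => (u \in 'C[w0]%g)%:R)) => [|u Wu].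
  by rewrite sum_natr_mem card_cent1_refl // m_odd mulVf ?pnatr_eq0.
rewrite cfun1E /= (cycle2g order_w0) cent1C mem_cent1_conj !inE.
by rewrite -[X in _ == X](conj1g u) (inj_eq (conjg_inj u)) -order_eq1 order_w0.
Qed.

Lemma Phi_SE x : x \in W ->
  Phi_S s t W x = (if x \in rot then m%:R * (x * x == 1)%g%:R else (odd m)%:R) - 1.
Proof.
move=> Wx; rewrite Phi_S_Ind // !cfunE cfun1E Wx; congr (_ - _).
by case: ifPn => rx; [rewrite cfInd_w0_rot | rewrite cfInd_w0_refl // in_refls Wx].
Qed.

Lemma Phi_S_mul_sgnS x : x \in W ->
  Phi_S s t W x * sgnS s t x = #|'C_T[x]%g|%:R - 1.
Proof.
move=> Wx; rewrite Phi_SE // sgnSE //; have [rx|r'x] := boolP (x \in rot).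
  rewrite cent1_refls_rot // mulr1.
  by case: (_ == _)%g; rewrite ?card_refls ?cards0 ?mulr1 ?mulr0.
rewrite card_cent1_refls_refl ?in_refls ?Wx // expr1.
by case: (odd m) => /=; ring.
Qed.

Local Open Scope group_scope.

Lemma rotX_inj i j : (i < m)%N -> (j < m)%N -> r ^+ i = r ^+ j -> i = j.
Proof.
by move=> lt_i lt_j /eqP; rewrite eq_expg_mod_order order_r !modn_small // => /eqP.
Qed.

Lemma rot_class_inj i j : (0 < i <= m./2)%N -> (0 < j <= m./2)%N ->
  (r ^+ i) ^: W = (r ^+ j) ^: W -> i = j.
Proof.
move=> i_half j_half eq_ij.
have /imsetP[y Wy] : r ^+ i \in (r ^+ j) ^: W by rewrite -eq_ij class_refl.
rewrite conj_rot ?mem_cycle //; case: ifP => _; first by apply: rotX_inj; lia.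
rewrite rot_expV; last lia.
by move/rotX_inj => eq_i; have := eq_i _ _; lia.
Qed.

Lemma rot_class_inv x : x \in rot -> x^-1 ^: W = x ^: W.
Proof. by move=> rx; rewrite -conj_rot_s // classGidl. Qed.

Lemma nontrivial_rot_classes :
  [set x ^: W | x in rot :\ 1]
    = [set (r ^+ j) ^: W | j : 'I_(m./2).+1 & (0 < j)%N].
Proof.
apply/setP=> A; apply/imsetP/imsetP=> [[x]|[j]].
  rewrite !inE andbC => /andP[/cyclePmin[k]]; rewrite order_r => lt_k -> rk_neq1 ->.
  have k_gt0 : (0 < k)%N by apply: contraR rk_neq1; rewrite -eqn0Ngt => /eqP->.
  have [le_k|gt_k] := leqP k m./2.
    by exists (inord k); rewrite ?inE inordK.
  have lt_mk : (m - k < m./2.+1)%N by lia.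
  exists (inord (m - k)); first by rewrite inE inordK //; lia.
  by rewrite inordK // -rot_expV ?rot_class_inv ?mem_cycle // ltnW.
rewrite inE => j_gt0 ->; exists (r ^+ j) => //; rewrite !inE mem_cycle andbT.
rewrite -order_dvdn order_r gtnNdvd //; have := ltn_ord j; lia.
Qed.

Lemma cent1_rotX j : 'C_W[r ^+ j] = if (m %| j.*2)%N then W else rot.
Proof.
have rV_eq : ((r ^+ j)^-1 == r ^+ j) = (m %| j.*2)%N.
  by rewrite eq_invg_mul -expgD addnn -order_dvdn order_r.
apply/setP=> x; rewrite in_setI; have [Wx|W'x] := boolP (x \in W) => /=.
  rewrite cent1C mem_cent1_conj conj_rot ?mem_cycle // fun_if.
  by rewrite -rV_eq; case: ifP; rewrite ?eqxx; case: ifP; rewrite ?Wx.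
by case: ifP => _; apply/esym/(contraNF _ W'x) => //; apply: rot_in_W.
Qed.

Local Open Scope ring_scope.

(** * The characters induced from centralisers *)

Section Characters.

Variable z : algC.
Hypothesis prim_z : m.-primitive_root z.

Lemma chi_rotX j k : chi s t m z j (r ^+ k)%g = z ^+ (j * k).
Proof.
rewrite /chi; case: pickP => [i /eqP/eqP|/(_ (Ordinal (ltn_pmod k (ltnW m_gt1))))] /=.
  rewrite eq_expg_mod_order order_r => /eqP ik.
  by rewrite !(mulnC j) !exprM -(prim_expr_mod prim_z i) ik (prim_expr_mod prim_z).
by rewrite -[X in (_ %% X)%N]order_r expg_mod_order eqxx.
Qed.

Lemma chiX j x : chi s t m z j x = chi s t m z 1 x ^+ j.
Proof. by rewrite /chi mul1n mulnC exprM. Qed.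

Lemma chiM j : {in rot &, {morph chi s t m z j : x y / (x * y)%g >-> x * y}}.
Proof.
move=> _ _ /cycleP[a ->] /cycleP[b ->].
by rewrite -expgD !chi_rotX mulnDr exprD.
Qed.

Lemma chi_1 j : chi s t m z j 1%g = 1.
Proof. by rewrite -(expg0 r) chi_rotX muln0. Qed.

Lemma chiV j x : x \in rot -> chi s t m z j x^-1%g = (chi s t m z j x)^-1.
Proof. by move=> rx; apply/esym/mulr1_eq; rewrite -chiM ?groupV // mulgV chi_1. Qed.

Lemma chi_eq1 j x : x \in rot -> (chi s t m z j x == 1) = (x ^+ j == 1)%g.
Proof.
case/cycleP=> k ->.
by rewrite chi_rotX -(prim_order_dvd prim_z) -expgM -order_dvdn order_r mulnC.
Qed.

Lemma chi_triv j : (m %| j)%N -> chi s t m z j =1 fun=> 1.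
Proof.
case/dvdnP=> q -> x; rewrite chiX mulnC exprM -chiX.
by rewrite /chi exprM (prim_expr_order prim_z) !expr1n.
Qed.

Lemma phi_morph j : phi s t m z j 1%g = 1 /\
  {in 'C_W[r ^+ j]%g &, {morph phi s t m z j : x y / (x * y)%g >-> x * y}}.
Proof.
have chi_morph k : chi s t m z k 1%g = 1 /\ {in if (m %| k)%N then W else <[r]>%G &,
    {morph chi s t m z k : x y / (x * y)%g >-> x * y}}.
  split; first exact: chi_1.
  by case: ifP => [/chi_triv chi1 x y _ _|_]; [rewrite !chi1 mulr1 | apply: chiM].
rewrite cent1_rotX /phi; have [m_odd|_] := boolP (odd m).
  by rewrite -mul2n Gauss_dvdr ?coprimen2 //; have := chi_morph j; case: ifP.
have [->|_] := eqVneq j.*2 m; last by have := chi_morph j.*2; case: ifP.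
have [eps eps_lin epsE] := sgnS_lin_char.
rewrite dvdnn; split=> [|x y Wx Wy]; first by rewrite -epsE ?group1 ?lin_char1.
by rewrite -!epsE ?groupM ?lin_charM.
Qed.

(* On rotations [phi_j] is [chi_j] or [chi_(2 j)], according to the parity of [m]. *)
Definition phi_root (x : gT) : algC := chi s t m z (2 - odd m) x.

Lemma phi_rot j x : x \in rot -> phi s t m z j x = phi_root x ^+ j.
Proof.
move=> rx; rewrite /phi_root chiX -exprM -chiX /phi.
case: (odd m); rewrite ?mul1n // mul2n; case: eqP => // ->.
by rewrite sgnSE ?rot_in_W // rx chi_triv.
Qed.

Lemma phi_rootV x : x \in rot -> phi_root x^-1%g = (phi_root x)^-1.
Proof. exact: chiV. Qed.

Lemma phi_root_eq1 x : x \in rot -> (phi_root x == 1) = (x * x == 1)%g.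
Proof.
move=> rx; rewrite /phi_root chi_eq1 // -expg2; have [m_odd|//] := boolP (odd m).
have ox_odd : odd #[x]%g by apply: dvdn_odd m_odd; rewrite -order_r order_dvdG.
by rewrite -!order_dvdn /= -[X in _ = (_ %| X)%N](mul1n 2) Gauss_dvdl ?coprimen2.
Qed.

Lemma cfInd_eq_W (G : {group gT}) (l : 'CF(G)) x : G :=: W -> 'Ind[W] l x = l x.
Proof. by move/group_inj=> defG; case: _ / (esym defG) l => l; rewrite cfInd_id. Qed.

Lemma cfInd_eq_rot (G : {group gT}) (l : 'CF(G)) x : G :=: rot -> x \in W ->
  'Ind[W] l x = if x \in rot then l x + l x^-1%g else 0.
Proof.
move=> defG Wx; have cardG : #|G| = m by rewrite defG -orderE order_r.
rewrite cfIndE ?defG ?rot_sub_W // cardG.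
have [rx|r'x] := boolP (x \in rot); last first.
  by rewrite big1 ?mulr0 // => y Wy; rewrite cfun0 // defG conj_in_rot.
rewrite (big_setID rot) (setIidPr rot_sub_W) -reflsE /=.
rewrite (eq_bigr (fun=> l x)) => [|y ry]; last by rewrite conj_rot ?ry ?rot_in_W.
rewrite [X in _ + X](eq_bigr (fun=> l x^-1%g)) => [|y Ty]; last first.
  by rewrite refl_conj_rot.
rewrite !sumr_const -orderE order_r card_refls -mulrnDl.
by rewrite -[(_ + _) *+ _]mulr_natl mulKf // pnatr_eq0 -lt0n ltnW.
Qed.

Section InducedSum.

Variable lam : forall j, 'CF('C_W[r ^+ j]%G).
Hypothesis lamE : forall j, {in 'C_W[r ^+ j]%g, lam j =1 phi s t m z j}.

Lemma cfInd_phi_lt_half j x : (0 < j)%N -> (j.*2 < m)%N -> x \in W ->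
  'Ind[W] (lam j) x = if x \in rot then phi_root x ^+ j + phi_root x ^- j else 0.
Proof.
move=> j_gt0 lt_jm Wx; have defC : 'C_W[r ^+ j]%g = rot.
  by rewrite cent1_rotX gtnNdvd ?double_gt0.
rewrite cfInd_eq_rot //; case: ifP => // rx.
by rewrite !lamE ?defC ?groupV // !phi_rot ?groupV // phi_rootV // exprVn.
Qed.

Lemma cfInd_phi_half j x : j.*2 = m -> x \in W -> 'Ind[W] (lam j) x = sgnS s t x.
Proof.
move=> jm Wx; have defC : 'C_W[r ^+ j]%g = W by rewrite cent1_rotX jm dvdnn.
rewrite cfInd_eq_W // lamE ?defC // /phi jm eqxx ifF //; lia.
Qed.

Lemma sum_cfInd_phi_odd x : odd m -> x \in W ->
  \sum_(1 <= j < m./2.+1) 'Ind[W] (lam j) x = Phi_S s t W x.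
Proof.
move=> m_odd Wx; rewrite Phi_SE // m_odd; set y := phi_root x.
rewrite (eq_big_nat _ _ (F2 := fun j => if x \in rot then y ^+ j + y ^- j else 0)).
  case: ifP => rx; last by rewrite big1 ?subrr.
  rewrite sum_odd_unity_root_sym ?phi_root_eq1 //.
  by rewrite /y /phi_root m_odd -chiX chi_triv.
by move=> j j_half; rewrite cfInd_phi_lt_half //; lia.
Qed.

Lemma sum_cfInd_phi_even x : ~~ odd m -> x \in W ->
  \sum_(1 <= j < m./2.+1) 'Ind[W] (lam j) x = Phi_S s t W x.
Proof.
move=> m_even Wx; rewrite Phi_SE // (negPf m_even); set y := phi_root x.
have half_gt0 : (0 < m./2)%N by lia.
have half_double : m./2.*2 = m by lia.
rewrite big_nat_recr //= (cfInd_phi_half half_double Wx) sgnSE //.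
rewrite (eq_big_nat _ _ (F2 := fun j => if x \in rot then y ^+ j + y ^- j else 0)).
  case: ifP => rx; last by rewrite big1.
  rewrite sum_unity_root_sym ?phi_root_eq1 //; last first.
    by rewrite /y /phi_root (negPf m_even) chiX -exprM -chiX mul2n half_double chi_triv.
  by rewrite -[in RHS]half_double -mul2n natrM; ring.
by move=> j j_half; rewrite cfInd_phi_lt_half //; lia.
Qed.

Lemma sum_cfInd_phi x : x \in W ->
  \sum_(1 <= j < m./2.+1) 'Ind[W] (lam j) x = Phi_S s t W x.
Proof.
by have [/sum_cfInd_phi_odd|/sum_cfInd_phi_even] := boolP (odd m); apply.
Qed.

End InducedSum.

End Characters.

(** * The reflection arrangement *)

Section Representation.

Variable rho : gT -> 'M[algC]_2.
Hypothesis rhoP : faithful_reflection_repr W s t rho.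

Lemma rho1 : rho 1%g = 1%:M.
Proof. by case: rhoP => -[]. Qed.

Lemma rhoM : {in W &, {morph rho : x y / (x * y)%g >-> x *m y}}.
Proof. by case: rhoP => -[]. Qed.

Lemma rhoX x n : x \in W -> rho (x ^+ n)%g = rho x ^+ n.
Proof.
move=> Wx; elim: n => [|n IHn]; first exact: rho1.
by rewrite expgS exprS rhoM ?groupX // IHn.
Qed.

Lemma rho_eq1 x : x \in W -> rho x = 1%:M -> x = 1%g.
Proof. by case: rhoP => _ inj_rho _ _ Wx rhox1; apply: inj_rho; rewrite ?rho1. Qed.

Lemma det_rho_involution x : x \in W -> (x * x = 1)%g -> \rank (rho x - 1%:M) = 1%N ->
  \det (rho x) = -1.
Proof.
move=> Wx xx1 rank1; have rho_sqr : rho x ^+ 2 = 1 by rewrite -rhoX // expg2 xx1 rho1.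
have /eqP : \det (rho x) ^+ 2 = 1.
  by rewrite expr2 -det_mulmx -[_ *m _]/(rho x ^+ 2) rho_sqr det1.
rewrite sqrf_eq1 => /orP[/eqP det1|/eqP//].
have rhox1 : rho x = 1.
  by apply: (det1_mx22_eq1 _ rho_sqr det1) => //; apply/eqP; rewrite det_mx22_eq0 rank1.
by move: rank1; rewrite rhox1 subrr mxrank0.
Qed.

Let det_s : \det (rho s) = -1.
Proof. by apply: det_rho_involution => //; case: rhoP. Qed.

Let det_t : \det (rho t) = -1.
Proof. by apply: det_rho_involution => //; case: rhoP. Qed.

Lemma det_rho_rot x : x \in rot -> \det (rho x) = 1.
Proof.
case/cycleP=> k ->; rewrite rhoX ?groupM //; elim: k => [|k IHk]; first exact: det1.
by rewrite exprS det_mulmx IHk rhoM // det_mulmx det_s det_t mulr1 mulrNN mulr1.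
Qed.

Lemma rot_eq1_fixed_vector x : x \in rot -> \det (rho x - 1%:M) = 0 -> x = 1%g.
Proof.
move=> rx det0; have Wx := rot_in_W rx; apply: rho_eq1 => //.
apply: (det1_mx22_eq1 (ltnW m_gt1) _ (det_rho_rot rx) det0).
by rewrite -rhoX // -order_r [#[_]%g]orderE expg_cardG // rho1.
Qed.

Lemma det_rho_refl_sub1 a : a \in T -> \det (rho a - 1%:M) = 0.
Proof.
rewrite in_refls => /andP[Wa r'a]; apply: det_sub1_reflection.
  by rewrite -rhoM // refl_mulxx // rho1.
have ras : (a * s)%g \in rot by rewrite mul_s_in_rot.
by rewrite -[a]mulsK rhoM ?(rot_in_W ras) // det_mulmx det_s det_rho_rot // mul1r.
Qed.

Lemma rank_rho_refl_sub1 a : a \in T -> \rank (rho a - 1%:M) = 1%N.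
Proof.
move=> Ta; move: (Ta); rewrite in_refls => /andP[Wa r'a].
have /eqP := det_rho_refl_sub1 Ta; rewrite det_mx22_eq0.
have := rank_leq_row (rho a - 1%:M); rewrite leq_eqVlt => /orP[/eqP->//|].
rewrite ltnS leq_eqVlt ltnS leqn0 mxrank_eq0 subr_eq0 => /orP[/eqP->//|/eqP rhoa1 _].
by rewrite (rho_eq1 Wa rhoa1) group1 in r'a.
Qed.

Lemma cuspidalE x : x \in W -> cuspidal rho x = (x \in rot) && (x != 1%g).
Proof.
move=> Wx; have -> : cuspidal rho x = (\det (rho x - 1%:M) != 0).
  by rewrite /cuspidal mxrank_ker det_mx22_eq0 negbK subn_eq0 eqn_leq rank_leq_row.
have [rx|r'x] := boolP (x \in rot); last first.
  by rewrite det_rho_refl_sub1 ?eqxx // in_refls Wx.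
congr (~~ _); apply/eqP/eqP=> [/(rot_eq1_fixed_vector rx)//|->].
by rewrite rho1 subrr det0.
Qed.

Lemma cuspidal_classes :
  [set x ^: W | x in W & cuspidal rho x]%g
    = [set (r ^+ j) ^: W | j : 'I_(m./2).+1 & (0 < j)%N]%g.
Proof.
have cusp_rot x : (x \in W) && cuspidal rho x = (x \in rot :\ 1%g).
  rewrite in_setD1 andbC; have [Wx|W'x] := boolP (x \in W).
    by rewrite cuspidalE // andbT andbC.
  by rewrite andbF; apply/esym/andP=> -[_ /rot_in_W]; apply/negP.
rewrite -nontrivial_rot_classes; apply/setP=> A.
apply/imsetP/imsetP=> [[x]|[x rx ->]]; last by exists x; rewrite // inE cusp_rot.
by rewrite inE cusp_rot => rx ->; exists x.
Qed.

(* Two reflections sharing their fixed line or their root line have a product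
   that is a rotation with a nonzero fixed vector. *)
Lemma refl_eq_fixed_vector a b : a \in T -> b \in T ->
  \det (rho (a * b)%g - 1%:M) = 0 -> a = b.
Proof.
rewrite !in_refls => /andP[Wa r'a] /andP[Wb r'b] det0.
have rab : (a * b)%g \in rot by rewrite mem_rotM // (negPf r'a) (negPf r'b).
by have /eqP := rot_eq1_fixed_vector rab det0; rewrite -eq_invg_mul refl_inv // => /eqP.
Qed.

Lemma hyp_inj : {in T &, injective (hyp rho)}.
Proof.
move=> a b Ta Tb /genmxP/andP[s_ab _]; apply: refl_eq_fixed_vector => //.
have [Wa Wb] := (refl_in_W Ta, refl_in_W Tb).
set K := kermx (rho a - 1%:M) in s_ab.
have K_neq0 : K != 0 by rewrite -mxrank_eq0 mxrank_ker rank_rho_refl_sub1.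
have K_fixed u : (K <= kermx (rho u - 1%:M))%MS -> K *m rho u = K.
  by move/sub_kermxP/eqP; rewrite mulmxBr mulmx1 subr_eq0 => /eqP.
apply/eqP; apply: contraR K_neq0; rewrite -unitfE -unitmxE => ab_unit.
rewrite -(mulmxK ab_unit K) mulmxBr mulmx1 rhoM // mulmxA !K_fixed //.
by rewrite subrr mul0mx.
Qed.

Lemma hypJ a w : a \in T -> w \in W ->
  <<hyp rho a *m rho w>>%MS = hyp rho (a ^ w)%g.
Proof.
move=> Ta Ww; apply/genmxP; have Wa := refl_in_W Ta.
have w_unit : rho w \in unitmx.
  have : rho w *m rho w^-1%g = 1%:M by rewrite -rhoM ?groupV // mulgV rho1.
  by case/mulmx1_unit.
have rank_ker u : u \in T -> \rank (kermx (rho u - 1%:M)) = 1%N.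
  by move=> Tu; rewrite mxrank_ker rank_rho_refl_sub1.
have TJ : (a ^ w)%g \in T by rewrite memJ_norm // (subsetP refls_norms).
have a_fixes : hyp rho a *m rho a = hyp rho a.
  apply/eqP; rewrite -subr_eq0 -{2}[hyp rho a]mulmx1 -mulmxBr; apply/eqP/sub_kermxP.
  by rewrite genmxE.
have sub : (hyp rho a *m rho w <= kermx (rho (a ^ w)%g - 1%:M))%MS.
  apply/sub_kermxP; rewrite mulmxBr mulmx1 -mulmxA -rhoM ?groupJ //.
  by rewrite conjgE mulKVg rhoM // mulmxA a_fixes subrr.
rewrite -(geq_leqif (mxrank_leqif_eq sub)).
by rewrite rank_ker // mxrankMfree ?row_free_unit // genmxE rank_ker.
Qed.

Lemma piA_cent1 w : w \in W -> piA s t W rho w = #|'C_T[w]%g|%:R.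
Proof.
move=> Ww; rewrite /piA /hyps undup_id; last first.
  rewrite map_inj_in_uniq ?enum_uniq // => a b; rewrite !mem_enum.
  exact: hyp_inj.
rewrite count_map -sum_natr_mem -sum1_count natr_sum -[RHS]big_enum /= big_mkcond.
rewrite [LHS]big_seq [RHS]big_seq; apply: eq_bigr => a; rewrite mem_enum => Ta.
rewrite hypJ // (inj_in_eq hyp_inj) ?memJ_norm ?(subsetP refls_norms) //.
by rewrite mem_cent1_conj; case: eqP.
Qed.

Lemma hdep_singletonF a : a \in T -> hdep rho [:: a] = false.
Proof. by move=> Ta; rewrite /hdep big_seq1 genmxE mxrank_tr rank_rho_refl_sub1. Qed.

Lemma hdep_pair_eq a b : a \in T -> b \in T -> hdep rho [:: a; b] -> a = b.
Proof.
move=> Ta Tb; rewrite /hdep !big_cons big_nil addsmx0_id /= ltnS => rank_le1.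
have [Wa Wb] := (refl_in_W Ta, refl_in_W Tb).
have : ((rho b - 1%:M)^T <= (rho a - 1%:M)^T)%MS.
  have sum_sub : (<<(rho a - 1%:M)^T>> + <<(rho b - 1%:M)^T>>
      <= <<(rho a - 1%:M)^T>>)%MS.
    rewrite -(geq_leqif (mxrank_leqif_sup (addsmxSl _ _))).
    by rewrite genmxE mxrank_tr rank_rho_refl_sub1.
  have := submx_trans (addsmxSr _ _) sum_sub.
  by rewrite !genmxE.
case/submxP=> D /(congr1 trmx); rewrite trmx_mul !trmxK => rho_bE.
apply: refl_eq_fixed_vector => //; rewrite rhoM //.
have -> : rho a *m rho b - 1%:M = (rho a - 1%:M) *m (rho b + D^T).
  by rewrite mulmxDr -rho_bE mulmxBl mul1mx addrA subrK.
by rewrite det_mulmx det_rho_refl_sub1 // mul0r.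
Qed.

Lemma hdep_triple (a b c : gT) : hdep rho [:: a; b; c].
Proof. exact: rank_leq_row. Qed.

Lemma OSrel_circuit_span : (OSrel s t W rho :=: circuit_span T)%MS.
Proof.
apply/eqmxP; rewrite /OSrel !addsmx_sub -!andbA; apply/and4P; split.
- apply/sumsmx_subP=> x Tx; apply/sumsmx_subP=> y Ty.
  apply/sumsmx_subP=> u /andP[Tu _]; rewrite genmxE.
  exact: circuit_rel_in_span.
- apply/sumsmx_subP=> u Tu; apply/sumsmx_subP=> x Tx.
  apply/sumsmx_subP=> y /andP[Ty /(hdep_pair_eq Tx Ty) ->].
  by rewrite genmxE subrr sub0mx.
- apply/sumsmx_subP=> u Tu; apply/sumsmx_subP=> v Tv.
  by apply/sumsmx_subP=> x /andP[/hdep_singletonF->].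
rewrite -addsmxA; apply: submx_trans (addsmxSl _ _).
apply/sumsmx_subP=> x Tx; rewrite (sumsmx_sup x) //.
apply/sumsmx_subP=> y Ty; rewrite (sumsmx_sup y) //.
apply/sumsmx_subP=> u Tu; rewrite (sumsmx_sup u) //.
by rewrite Tu hdep_triple.
Qed.

Lemma Psi_S_cent1 w : w \in W -> Psi_S s t W rho w = #|'C_T[w]%g|%:R - 1.
Proof.
move=> Ww; rewrite [LHS]/(quot_trace (wedge_span T) _ _).
apply: quot_trace_circuit_span OSrel_circuit_span _.
  by rewrite card_refls ltnW.
by rewrite (subsetP refls_norms).
Qed.

End Representation.

End Dihedral.

Theorem theorem5p11 (gT : finGroupType) (W : {group gT}) (s t : gT) (m : nat)
    (rho : gT -> 'M[algC]_2) (z : algC) :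
  (2 <= m)%N -> #[s]%g = 2%N -> #[t]%g = 2%N -> #[(s * t)%g]%g = m ->
  W :=: <<[set s; t]>>%g ->
  mx_repr W rho -> {in W &, injective rho} ->
  \rank (rho s - 1%:M) = 1%N -> \rank (rho t - 1%:M) = 1%N ->
  m.-primitive_root z ->
  let w0 := longest s t W in
  [/\ {in W, forall x, Phi_S s t W x = ('Ind[W, <[w0]>%G] 1 - 1) x},
      {in W, forall x, Psi_S s t W rho x = piA s t W rho x - 1
                       /\ Psi_S s t W rho x = Phi_S s t W x * sgnS s t x},
      [set x ^: W | x in W & cuspidal rho x]%g
        = [set ((s * t) ^+ j) ^: W | j : 'I_(m./2).+1 & (0 < j)%N]%g,
      (forall i j : nat, (0 < i <= m./2)%N -> (0 < j <= m./2)%N ->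
         ((s * t) ^+ i) ^: W = ((s * t) ^+ j) ^: W -> i = j)%g
    & exists (lam mu : forall j : nat, 'CF(('C_W[(s * t) ^+ j])%G)),
      [/\ forall j : nat, (0 < j <= m./2)%N ->
            [/\ lam j \is a linear_char, mu j \is a linear_char,
                {in ('C_W[(s * t) ^+ j])%g, forall x, lam j x = phi s t m z j x}
              & {in ('C_W[(s * t) ^+ j])%g, forall x, mu j x = psi s t m z j x}],
          {in W, forall x, Phi_S s t W x = \sum_(1 <= j < (m./2).+1) ('Ind[W] (lam j)) x}
        & {in W, forall x, Psi_S s t W rho x = \sum_(1 <= j < (m./2).+1) ('Ind[W] (mu j)) x}]].
Proof.
move=> m_gt1 order_s order_t order_st defW reprW inj_rho rank_s rank_t prim_z w0.
have dihW : dihedral_system W s t m by [].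
have rhoP : faithful_reflection_repr W s t rho by [].
have Psi_Phi x : x \in W -> Psi_S s t W rho x = Phi_S s t W x * sgnS s t x.
  by move=> Wx; rewrite (Psi_S_cent1 dihW) // (Phi_S_mul_sgnS dihW).
have [eps eps_lin epsE] := sgnS_lin_char dihW.
have /all_sig2[lam lam_lin lamE] j : {l : 'CF('C_W[(s * t) ^+ j]%G) |
    l \is a linear_char & {in 'C_W[(s * t) ^+ j]%g, l =1 phi s t m z j}}.
  by have [phi1 phiM] := phi_morph dihW prim_z j; apply: lin_char_of_morph.
split.
- by move=> x Wx; rewrite /w0 (longestE dihW) (Phi_S_Ind dihW).
- by move=> x Wx; rewrite -Psi_Phi // (Psi_S_cent1 dihW) // (piA_cent1 dihW).
- exact: (cuspidal_classes dihW rhoP).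
- exact: (rot_class_inj dihW).
exists lam, (fun j => lam j * 'Res eps); split=> [j _|x Wx|x Wx].
- split=> //; first by rewrite rpredM ?cfRes_lin_char ?lam_lin.
  move=> x Cx; have [Wx _] := setIP Cx.
  by rewrite cfunE lamE // cfResE ?subsetIl // epsE.
- by rewrite (sum_cfInd_phi dihW prim_z).
rewrite Psi_Phi // -(sum_cfInd_phi dihW prim_z lamE) // mulr_suml.
by apply: eq_bigr => j _; rewrite cfIndM ?subsetIl // cfunE epsE.
Qed.
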